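(* There is an extensional ESO sentence $\Psi$ such that the problem described by $\Psi$ is polynomial-time equivalent to the Graph Isomorphism problem (given two finite graphs, decide whether they are isomorphic).
   Context: All signatures are finite and relational, and all structures have non-empty domains. An ESO $\tau$-sentence has the form $\exists R_1,\dots,R_k.\,\phi$, where $R_1,\dots,R_k\notin\tau$ and $\phi$ is a first-order $(\tau\cup\{R_1,\dots,R_k\})$-sentence. The problem it describes is the class of finite $\tau$-structures satisfying it. It is extensional if for every existentially quantified predicate $R$ there is a distinct symbol $R'\in\tau$ of the same arity such that the sentence contains a conjunct $\forall\bar x\,(R'(\bar x)\Rightarrow R(\bar x))$, and $R'$ does not appear anywhere else in the sentence. Two problems are polynomial-time equivalent if there are polynomial-time many-one reductions in both directions. *)

(* Defs.v *)
From mathcomp Require Import all_boot.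

Set Implicit Arguments.
Unset Strict Implicit.
Unset Printing Implicit Defensive.

Record signature := Signature { symbol :> finType; arity : symbol -> nat }.

(* Disjoint union of signatures. *)
Definition sig_union (S T : signature) : signature :=
  @Signature (S + T)%type
    (fun R => match R with inl R => arity R | inr R => arity R end).

(* Variables are natural numbers, and binders name the variable they bind. *)
Inductive formula (S : signature) : Type :=
  | Eq of nat & nat
  | Rel (R : S) of (arity R).-tuple nat
  | Not of formula S
  | And of formula S & formula S
  | Or of formula S & formula S
  | Imp of formula S & formula S
  | All of nat & formula S
  | Ex of nat & formula S.

Arguments Eq {S}.
Arguments Rel {S}.

Fixpoint free_vars (S : signature) (phi : formula S) : seq nat :=
  match phi with
  | Eq x y => [:: x; y]
  | Rel _ xs => xs
  | Not a => free_vars a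
  | And a b | Or a b | Imp a b => free_vars a ++ free_vars b
  | All x a | Ex x a => [seq y <- free_vars a | y != x]
  end.

Definition sentence (S : signature) (phi : formula S) : Prop :=
  free_vars phi = [::].

Definition structure (S : signature) (D : Type) : Type :=
  forall R : S, pred ((arity R).-tuple D).

Fixpoint sat (S : signature) (D : Type) (A : structure S D) (v : nat -> D)
    (phi : formula S) : Prop :=
  match phi with
  | Eq x y => v x = v y
  | Rel R xs => A R (map_tuple v xs)
  | Not a => ~ sat A v a
  | And a b => sat A v a /\ sat A v b
  | Or a b => sat A v a \/ sat A v b
  | Imp a b => sat A v a -> sat A v b
  | All x a => forall d : D, sat A (fun y => if y == x then d else v y) a
  | Ex x a => exists d : D, sat A (fun y => if y == x then d else v y) a
  end.

(* The tau + sigma structure expanding A by the relations B. *)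
Definition expand (tau sigma : signature) (D : Type)
    (A : structure tau D) (B : structure sigma D) :
    structure (sig_union tau sigma) D :=
  fun R => match R with inl R => A R | inr R => B R end.

(* [eso_sig] collects the quantified predicates R_1, ..., R_k. *)
Record eso (tau : signature) := Eso {
  eso_sig : signature;
  eso_body : formula (sig_union tau eso_sig);
  eso_sentence : sentence eso_body }.

(* The valuation is irrelevant since the body is a sentence. *)
Definition eso_models (tau : signature) (D : Type) (A : structure tau D)
    (Psi : eso tau) : Prop :=
  exists B : structure (eso_sig Psi) D,
    forall v : nat -> D, sat (expand A B) v (eso_body Psi).

(* psi is one of the conjuncts of phi, seen as an iterated conjunction. *)
Fixpoint conjunct (S : signature) (psi phi : formula S) : Prop :=
  psi = phi \/
  match phi with
  | And a b => conjunct psi a \/ conjunct psi b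
  | _ => False
  end.

(* Number of atoms of phi whose relation symbol is R. *)
Fixpoint occurrences (S : signature) (R : S) (phi : formula S) : nat :=
  match phi with
  | Eq _ _ => 0
  | Rel R' _ => R' == R
  | Not a => occurrences R a
  | And a b | Or a b | Imp a b => occurrences R a + occurrences R b
  | All _ a | Ex _ a => occurrences R a
  end.

Definition foralls (S : signature) (xs : seq nat) (phi : formula S) :=
  foldr (@All S) phi xs.

(* [prime R] is the symbol R' attached to R.  The tuples [xs'] and [xs] are the
   same list of variables, typed by the equal arities of R' and R.  The given
   conjunct contains exactly one atom R'(..), so [occurrences = 1] says that
   R' appears nowhere else. *)
Definition extensional (tau : signature) (Psi : eso tau) : Prop :=
  exists prime : eso_sig Psi -> tau,
    injective prime /\
    forall R : eso_sig Psi,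
      [/\ arity (prime R) = arity R,
          exists (xs' : (arity (prime R)).-tuple nat)
                 (xs : (arity R).-tuple nat),
            [/\ tval xs' = tval xs,
                uniq xs &
                conjunct
                  (foralls xs
                    (Imp (@Rel (sig_union tau (eso_sig Psi))
                            (inl (prime R)) xs')
                         (@Rel (sig_union tau (eso_sig Psi)) (inr R) xs)))
                  (eso_body Psi)] &
          occurrences (S := sig_union tau (eso_sig Psi)) (inl (prime R))
            (eso_body Psi) = 1].

(* Deterministic Turing machines with finitely many two-way infinite tapes.
   A cell is blank (None), or contains a bit, or an auxiliary symbol. *)

Inductive move := MoveL | Stay | MoveR.

Definition cell (G : Type) : Type := option (bool + G).

(* Cells left of the head, nearest first, and cells from the head rightwards;
   all other cells are blank. *)
Definition tape (G : Type) : Type := (seq (cell G) * seq (cell G))%type.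

Definition tape_read (G : Type) (t : tape G) : cell G := head None t.2.

Definition tape_write (G : Type) (a : cell G) (t : tape G) : tape G :=
  (t.1, a :: behead t.2).

Definition tape_move (G : Type) (m : move) (t : tape G) : tape G :=
  match m with
  | MoveL => (behead t.1, head None t.1 :: t.2)
  | Stay => t
  | MoveR => (tape_read t :: t.1, behead t.2)
  end.

Definition bit_cells (G : Type) (w : seq bool) : seq (cell G) :=
  [seq Some (inl b) | b <- w].

(* The tape contains the word w and is blank elsewhere, with the head at an
   arbitrary position. *)
Definition tape_holds (G : Type) (t : tape G) (w : seq bool) : Prop :=
  exists i j : nat,
    rev t.1 ++ t.2 = nseq i None ++ bit_cells G w ++ nseq j None.

Record machine := Machine {
  state : finType;
  aux : finType;
  tapes : finType;
  tape_in : tapes;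
  tape_out : tapes;
  start : state;
  halting : pred state;
  delta : state -> {ffun tapes -> cell aux} ->
          state * {ffun tapes -> cell aux * move} }.

Definition config (M : machine) : Type :=
  (state M * {ffun tapes M -> tape (aux M)})%type.

Definition init (M : machine) (w : seq bool) : config M :=
  (start M,
   [ffun i => if i == tape_in M then ([::], bit_cells (aux M) w)
              else ([::], [::])]).

Definition step (M : machine) (c : config M) : config M :=
  if halting c.1 then c else
  let r := delta c.1 [ffun i => tape_read (c.2 i)] in
  (r.1, [ffun i => tape_move (r.2 i).2 (tape_write (r.2 i).1 (c.2 i))]).

(* M on input w halts within n steps and outputs w'. *)
Definition outputs_within (M : machine) (w : seq bool) (n : nat)
    (w' : seq bool) : Prop :=
  let c := iter n (@step M) (init M w) in
  halting c.1 /\ tape_holds (c.2 (tape_out M)) w'.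

Record problem := Problem {
  instance : Type;
  encode : instance -> seq bool;
  yes : instance -> Prop }.

Definition poly_time (P Q : problem) (f : instance P -> instance Q) : Prop :=
  exists (M : machine) (c k : nat), forall x : instance P,
    outputs_within M (encode x) (c * size (encode x) ^ k + c) (encode (f x)).

Definition poly_reducible (P Q : problem) : Prop :=
  exists f : instance P -> instance Q,
    poly_time f /\ forall x : instance P, yes x <-> yes (f x).

Definition poly_equivalent (P Q : problem) : Prop :=
  poly_reducible P Q /\ poly_reducible Q P.

(* The k-tuples of elements of e, in lexicographic order. *)
Fixpoint lex_tuples (T : Type) (e : seq T) (k : nat) : seq (k.-tuple T) :=
  match k with
  | 0 => [:: [tuple]]
  | k'.+1 => [seq cons_tuple x t | x <- e, t <- lex_tuples e k']
  end.

(* As machine inputs, finite structures have a domain {0, ..., n}: this covers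
   all finite non-empty structures up to isomorphism. *)
Record fin_structure (tau : signature) := FinStructure {
  dom_pred : nat;
  interp : structure tau 'I_dom_pred.+1 }.

Arguments interp {tau} f R.

(* The domain size in unary, then the characteristic bit string of each
   relation. *)
Definition encode_structure (tau : signature) (A : fin_structure tau) :
    seq bool :=
  nseq (dom_pred A).+1 true ++ false ::
  flatten [seq [seq interp A R t
               | t <- lex_tuples (enum 'I_(dom_pred A).+1) (arity R)]
          | R <- enum (symbol tau)].

Definition eso_problem (tau : signature) (Psi : eso tau) : problem :=
  {| instance := fin_structure tau;
     encode := @encode_structure tau;
     yes := fun A => eso_models (interp A) Psi |}.

(* Finite simple undirected graphs, with vertex set {0, ..., n}. *)
Record graph := Graph {
  vert_pred : nat;
  adj : rel 'I_vert_pred.+1;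
  adj_sym : symmetric adj;
  adj_irr : irreflexive adj }.

Definition isomorphic (G H : graph) : Prop :=
  exists f : 'I_(vert_pred G).+1 -> 'I_(vert_pred H).+1,
    bijective f /\ forall x y, adj (f x) (f y) = adj x y.

(* The number of vertices in unary, then the adjacency matrix. *)
Definition encode_graph (G : graph) : seq bool :=
  nseq (vert_pred G).+1 true ++ false ::
  [seq adj x y | x <- enum 'I_(vert_pred G).+1,
                 y <- enum 'I_(vert_pred G).+1].

Definition graph_isomorphism : problem :=
  {| instance := (graph * graph)%type;
     encode := fun p => encode_graph p.1 ++ encode_graph p.2;
     yes := fun p => isomorphic p.1 p.2 |}.

(* Main.v *)
Require Import Defs.
From mathcomp Require Import all_boot all_algebra.
From mathcomp Require Import zify.
From Stdlib Require Import Setoid.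

Set Implicit Arguments.
Unset Strict Implicit.
Unset Printing Implicit Defensive.

Import GRing.Theory.

(** The sentence says that the quantified binary predicate R describes a
bijection of the domain that extends the input relation R' and carries the
edges of a relation E1 to the edges of a relation E2 (the edges of a relation
are its pairs without loops and directions).  So the problem is graph
isomorphism in which the images of some vertices are prescribed, and both
reductions rest on the fact that prescribed images can be added to, or removed
from, an isomorphism question.

From graph isomorphism to the sentence: the domain consists of the vertices of
the first graph G and one new point, E1 and E2 are the adjacencies of G and H,
and R' prescribes that the new point is fixed, so that only the two graphs
remain to be matched.  If the sizes of G and H differ, R' is made the full
relation on at least two points, which no function extends
([isomorphic_pinned_iso], [pinned_iso_isomorphic]).

From the sentence to graph isomorphism: each of the two graphs gets, besides the
domain, one label vertex per element and a rigid part whose vertices are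
recognised by their degrees.  The rigid part identifies every label vertex by
its neighbours, so an isomorphism of the two extended graphs fixes the labels.
A pair (a, b) of R' is expressed by joining a to the label b on the first side;
on the second side every b in the range of R' is joined to the label b only
([gadget_isomorphic_pinned_map], [pinned_map_gadget_isomorphic]).

Both outputs are sequences of square bit matrices whose entries depend on
boundedly many input bits, at positions given by polynomials in the loop
indices.  They are therefore written by programs made of head movements, output
instructions and loops that run n times, where n is the number of ones at the
start of the input.  Such programs compile to Turing machines
([compiled_outputs]) and need polynomial time because the depth of their loops
is fixed ([run_time_poly]); together this gives [poly_time_writes], through
which both reductions are shown to be in polynomial time. *)

(** * Loop programs *)

Definition displacement (m : move) : int :=
  match m with MoveL => (-1)%R | Stay => 0%R | MoveR => 1%R end.

(** A position is an integer because a head may leave the word on the left. *)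
Definition bit_at (w : seq bool) (z : int) : option bool :=
  if z is Posz k then onth w k else None.

Section Programs.

Variables H C : finType.

(** Heads move on read-only copies of the input word; an [Act] sees the bits
under the heads ([None] off the word) and one flag, sets the flag and may output
a bit.  The counter in [For] only names the tape that controls the loop, so the
body cannot use the loop index: it has to be reflected in the head positions. *)
Inductive program : Type :=
  | Move of (H -> move)
  | Act of (bool -> {ffun H -> option bool} -> bool * option bool)
  | Then of program & program
  | For of C & program.

(** Head positions, flag, and output written so far. *)
Definition store : Type := ({ffun H -> int} * bool * seq bool)%type.

Definition reads (X : finType) (w : seq bool) (p : {ffun X -> int}) :
    {ffun X -> option bool} := [ffun x => bit_at w (p x)].

Definition shift (X : finType) (p : {ffun X -> int}) (v : X -> move) :
    {ffun X -> int} := [ffun x => (p x + displacement (v x))%R].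

Fixpoint exec (w : seq bool) (n : nat) (p : program) (s : store) : store :=
  match p with
  | Move v => (shift s.1.1 v, s.1.2, s.2)
  | Act a => let r := a s.1.2 (reads w s.1.1) in
             (s.1.1, r.1, s.2 ++ seq_of_opt r.2)
  | Then p q => exec w n q (exec w n p s)
  | For _ p => iter n (exec w n p) s
  end.

Fixpoint counters (p : program) : seq C :=
  match p with
  | Then p q => counters p ++ counters q
  | For c p => c :: counters p
  | _ => [::]
  end.

(** Nested loops must use different tapes, while consecutive ones may share a
tape since a loop returns its head to the start. *)
Fixpoint well_nested (p : program) : bool :=
  match p with
  | Then p q => well_nested p && well_nested q
  | For c p => (c \notin counters p) && well_nested p
  | _ => true
  end.

(** One iteration costs the test and the body; after the last test the control
head walks back over the [n] ones and steps onto the word again. *)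
Fixpoint run_time (n : nat) (p : program) : nat :=
  match p with
  | Then p q => run_time n p + run_time n q
  | For _ p => n * (run_time n p).+1 + n.+2
  | _ => 1
  end.

Lemma run_time_poly p : exists c k, forall n, run_time n p <= c * n.+1 ^ k.
Proof.
elim: p => [v|a|p [c [k Hp]] q [d [l Hq]]|c p [d [k Hp]]] /=.
- by exists 1, 0.
- by exists 1, 0.
- exists (c + d), (k + l) => n; rewrite mulnDl expnD.
  apply: leq_add.
    by apply: leq_trans (Hp n) _; rewrite mulnA leq_pmulr // expn_gt0.
  apply: leq_trans (Hq n) _.
  by rewrite [n.+1 ^ k * _]mulnC mulnA leq_pmulr // expn_gt0.
- exists (d + 3), k.+1 => n; rewrite expnS.
  have := Hp n; have : 0 < n.+1 ^ k by rewrite expn_gt0.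
  move: (run_time n p) (n.+1 ^ k) => t u; nia.
Qed.

(** * Control flow of a program as a finite automaton *)

(** In a loop, [inl true] is the test and [inl false] is the phase that rewinds
the control head. *)
Fixpoint pc (p : program) : finType :=
  match p with
  | Move _ | Act _ => unit
  | Then p q => (pc p + pc q)%type
  | For _ p => (bool + pc p)%type
  end.

Fixpoint entry (p : program) : pc p :=
  match p with
  | Move _ | Act _ => tt
  | Then p q => inl (entry p)
  | For _ p => inl true
  end.

(** The target [goto] is optional in [next], where [None] means that the program
has finished; the enclosing program then decides how to continue. *)
Record reaction (X : Type) := Reaction {
  goto : X; flag : bool; hmove : H -> move; cmove : C -> move;
  emit : option bool }.

Definition redirect X Y (f : X -> Y) (r : reaction X) : reaction Y :=
  Reaction (f (goto r)) (flag r) (hmove r) (cmove r) (emit r).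

(** The control tape of a loop is one more copy of the input: its head reads
[true] at the positions below [n] and [false] at [n], which ends the loop, and
the blank before the word marks the start when rewinding. *)
Fixpoint next (p : program) : pc p -> bool -> {ffun H -> option bool} ->
    {ffun C -> option bool} -> reaction (option (pc p)) :=
  match p return pc p -> bool -> {ffun H -> option bool} ->
    {ffun C -> option bool} -> reaction (option (pc p)) with
  | Move v => fun _ f _ _ => Reaction None f v (fun=> Stay) None
  | Act a => fun _ f rh _ =>
      Reaction None (a f rh).1 (fun=> Stay) (fun=> Stay) (a f rh).2
  | Then p q => fun s f rh rc =>
      match s with
      | inl s => redirect
          (fun g => Some (if g is Some s' then inl s' else inr (entry q)))
          (next s f rh rc)
      | inr s => redirect (omap inr) (next s f rh rc)
      end
  | For c p => fun s f rh rc =>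
      let move_c m := fun c' => if c' == c then m else Stay in
      match s with
      | inl true =>
          if rc c == Some true
          then Reaction (Some (inr (entry p))) f (fun=> Stay) (move_c MoveR)
                 None
          else Reaction (Some (inl false)) f (fun=> Stay) (move_c MoveL) None
      | inl false =>
          if rc c is Some _
          then Reaction (Some (inl false)) f (fun=> Stay) (move_c MoveL) None
          else Reaction None f (fun=> Stay) (move_c MoveR) None
      | inr s => redirect
          (fun g => Some (if g is Some s' then inr s' else inl true))
          (next s f rh rc)
      end
  end.

Section Control.

Variables (P : program) (w : seq bool).

(** State, store, and positions of the control heads. *)
Definition control : Type := (option (pc P) * store * {ffun C -> int})%type.

Definition control_step (a : control) : control :=
  let: (g, s, cp) := a in
  if g is Some q then
    let r := next q s.1.2 (reads w s.1.1) (reads w cp) in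
    (goto r, (shift s.1.1 (hmove r), flag r, s.2 ++ seq_of_opt (emit r)),
     shift cp (cmove r))
  else a.

Definition reaches (t : nat) (a b : control) : Prop :=
  exists2 t', t' <= t & iter t' control_step a = b.

Lemma reaches_refl t a : reaches t a a.
Proof. by exists 0. Qed.

Lemma reaches_trans t u a b c :
  reaches t a b -> reaches u b c -> reaches (t + u) a c.
Proof.
move=> [t' lt <-] [u' lu <-]; exists (u' + t'); first by rewrite addnC leq_add.
by rewrite iterD.
Qed.

Lemma reaches1 a b : control_step a = b -> reaches 1 a b.
Proof. by move=> E; exists 1. Qed.

Lemma shift_stay (X : finType) (p : {ffun X -> int}) : shift p (fun=> Stay) = p.
Proof. by apply/ffunP => x; rewrite ffunE addr0. Qed.

Variables (n : nat) (rest : seq bool).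
Hypothesis w_def : w = nseq n true ++ false :: rest.

Definition set_counter (cp : {ffun C -> int}) c (z : int) : {ffun C -> int} :=
  [ffun c' => if c' == c then z else cp c'].

Lemma bit_at_lt k : k < n -> bit_at w k = Some true.
Proof.
move=> kn; rewrite /= w_def onthE map_cat nth_cat size_map size_nseq kn.
by rewrite (nth_map true) ?size_nseq // nth_nseq kn.
Qed.

Lemma bit_at_eq : bit_at w n = Some false.
Proof.
by rewrite /= w_def onthE map_cat nth_cat size_map size_nseq ltnn subnn.
Qed.

Lemma set_counter_shift cp c z m :
  shift (set_counter cp c z) (fun c' => if c' == c then m else Stay)
    = set_counter cp c (z + displacement m)%R.
Proof.
by apply/ffunP => x; rewrite !ffunE; case: eqP => // _; rewrite addr0.
Qed.

Lemma reads_set_counter cp c z : reads w (set_counter cp c z) c = bit_at w z.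
Proof. by rewrite !ffunE eqxx. Qed.

(** The automaton of [p] runs inside that of [P], where [emb None] is the state
in which [P] continues after [p]. *)
Definition embeds (p : program) (emb : option (pc p) -> option (pc P)) : Prop :=
  forall q, exists2 q', emb (Some q) = Some q' &
    forall f rh rc, next q' f rh rc = redirect emb (next q f rh rc).

Lemma control_step_embed p emb (q : pc p) s cp : @embeds p emb ->
  let r := next q s.1.2 (reads w s.1.1) (reads w cp) in
  control_step (emb (Some q), s, cp) =
  (emb (goto r), (shift s.1.1 (hmove r), flag r, s.2 ++ seq_of_opt (emit r)),
   shift cp (cmove r)).
Proof. by move=> /(_ q) [q' /= -> ->]. Qed.

Lemma redirect_comp X Y Z (f : Y -> Z) (g : X -> Y) r :
  redirect f (redirect g r) = redirect (f \o g) r.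
Proof. by []. Qed.

Lemma eq_redirect X Y (f g : X -> Y) r : f =1 g -> redirect f r = redirect g r.
Proof. by rewrite /redirect => ->. Qed.

(** Induction on the program: the embedding [emb] plays the role of a
continuation, so that a part of a program is handled without mentioning what
surrounds it.  The control heads are back at their initial positions afterwards,
which allows the loop to be entered again. *)
Lemma control_exec p emb s (cp : {ffun C -> int}) : @embeds p emb ->
  well_nested p -> {in counters p, forall c, cp c = 0%R} ->
  reaches (run_time n p) (emb (Some (entry p)), s, cp)
    (emb None, exec w n p s, cp).
Proof.
elim: p emb s cp => [v|a|p IHp q IHq|c p IHp] emb s cp Hemb /=.
- move=> _ _; apply: reaches1.
  by rewrite (control_step_embed _ _ _ Hemb) /= shift_stay cats0.
- move=> _ _; apply: reaches1.
  by rewrite (control_step_embed _ _ _ Hemb) /= !shift_stay.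
- move=> /andP[Wp Wq] Z.
  pose embp g := emb (Some (if g is Some s' then inl s' else inr (entry q))).
  pose embq (g : option (pc q)) := emb (omap inr g).
  apply: (@reaches_trans _ _ _ (embq (Some (entry q)), exec w n p s, cp)).
    apply: (IHp embp) => // [r|c cp0]; last by apply: Z; rewrite mem_cat cp0.
    have [q' E1 E2] := Hemb (inl r).
    exists q' => // f rh rc; rewrite E2 /= redirect_comp; exact: eq_redirect.
  apply: (IHq embq) => // [r|c cp0]; last by apply: Z; rewrite mem_cat cp0 orbT.
  have [q' E1 E2] := Hemb (inr r).
  by exists q' => // f rh rc; rewrite E2 /= redirect_comp; apply: eq_redirect.
- move=> /andP[Nc Wp] Z.
  pose embp g := emb (Some (if g is Some s' then inr s' else inl true)).
  have Hp : embeds embp.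
    move=> r; have [q' E1 E2] := Hemb (inr r).
    by exists q' => // f rh rc; rewrite E2 /= redirect_comp; apply: eq_redirect.
  have cpE : cp = set_counter cp c 0%R.
    apply/ffunP => x; rewrite ffunE; case: eqP => // ->.
    by apply: Z; rewrite inE eqxx.
  have Zp z : {in counters p, forall x, set_counter cp c z x = 0%R}.
    move=> x xp; rewrite ffunE; case: eqP xp Nc => [-> ->//|_ xp _].
    by apply: Z; rewrite inE xp orbT.
  (* The control head advances by one position per iteration. *)
  have up k : k <= n -> reaches (k * (run_time n p).+1)
      (emb (Some (inl true)), s, set_counter cp c 0%R)
      (emb (Some (inl true)), iter k (exec w n p) s, set_counter cp c k).
    elim: k => [|k IHk] kn; first exact: reaches_refl.
    rewrite mulSnr; apply: reaches_trans (IHk (ltnW kn)) _.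
    rewrite -add1n.
    apply: (@reaches_trans _ _ _ (embp (Some (entry p)), iter k (exec w n p) s,
              set_counter cp c k.+1)).
      apply: reaches1; rewrite (control_step_embed _ _ _ Hemb) /=.
      rewrite reads_set_counter bit_at_lt //= set_counter_shift shift_stay.
      rewrite cats0.
      by rewrite /= -PoszD addn1; case: (iter k _ s) => [[]].
    exact: IHp.
  (* Rewinding from position k - 1 passes the blank at position -1. *)
  have down k : k <= n -> reaches k.+1
      (emb (Some (inl false)), exec w n (For c p) s,
        set_counter cp c (k%:Z - 1)%R)
      (emb None, exec w n (For c p) s, set_counter cp c 0%R).
    move: (exec w n (For c p) s) => s'.
    elim: k => [|k IHk] kn.
      apply: reaches1; rewrite (control_step_embed _ _ _ Hemb) /=.
      rewrite reads_set_counter /= set_counter_shift shift_stay cats0.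
      by case: s' => [[]].
    rewrite -[k.+2]add1n; apply: reaches_trans (reaches1 _) (IHk (ltnW kn)).
    rewrite (control_step_embed _ _ _ Hemb) /= reads_set_counter.
    have -> : (k.+1%:Z - 1 = k%:Z)%R by lia.
    rewrite bit_at_lt //= set_counter_shift shift_stay cats0.
    by case: s' {IHk} => [[]].
  rewrite {1}cpE; apply: reaches_trans (up n (leqnn n)) _.
  rewrite -[n.+2]add1n; apply: reaches_trans (reaches1 _) _; last first.
    by rewrite [X in (_, _, X)]cpE; exact: (down n (leqnn n)).
  rewrite (control_step_embed _ _ _ Hemb) /= reads_set_counter bit_at_eq /=.
  by rewrite set_counter_shift shift_stay cats0; case: (iter n _ s) => [[]].
Qed.


End Control.

(** * Compilation to Turing machines *)

Section Compile.

Variable P : program.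

(** [None] is the output tape, [Some None] the input tape; the others carry the
heads and the loop counters. *)
Definition compiled_tapes : finType := option (option (H + C)).

(** [inl true] copies the input to all the other tapes, [inl false] moves all
heads back, and [inr] runs the control automaton. *)
Definition compiled_state : finType := (bool + (option (pc P) * bool))%type.

Definition bit_of (c : cell void) : option bool :=
  if c is Some (inl b) then Some b else None.

Definition keep (rd : {ffun compiled_tapes -> cell void})
    (m : compiled_tapes -> move) : {ffun compiled_tapes -> cell void * move} :=
  [ffun x => (rd x, m x)].

Definition input_moves (m : move) (x : compiled_tapes) : move :=
  if x is Some _ then m else Stay.

Definition control_moves (r : reaction (option (pc P))) (x : compiled_tapes) :=
  match x with
  | Some (Some (inl h)) => hmove r h
  | Some (Some (inr c)) => cmove r c
  | _ => Stay
  end.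

Definition compiled_delta (s : compiled_state)
    (rd : {ffun compiled_tapes -> cell void}) :
    compiled_state * {ffun compiled_tapes -> cell void * move} :=
  match s with
  | inl true =>
      if rd (Some None) is Some _ then
        (inl true, [ffun x => if x is Some _ then (rd (Some None), MoveR)
                              else (rd None, Stay)])
      else (inl false, keep rd (input_moves MoveL))
  | inl false =>
      if rd (Some None) is Some _ then (inl false, keep rd (input_moves MoveL))
      else (inr (Some (entry P), false), keep rd (input_moves MoveR))
  | inr (None, f) => (inr (None, f), keep rd (fun=> Stay))
  | inr (Some q, f) =>
      let r := next q f [ffun h => bit_of (rd (Some (Some (inl h))))]
                        [ffun c => bit_of (rd (Some (Some (inr c))))] in
      (inr (goto r, flag r),
       [ffun x => match x, emit r with
                  | None, Some b => (Some (inl b), MoveR)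
                  | _, _ => (rd x, control_moves r x)
                  end])
  end.

Definition compiled : machine :=
  @Machine compiled_state void compiled_tapes (Some None) None (inl true)
    (fun s => if s is inr (None, _) then true else false) compiled_delta.

(** The tape contains [w] from position 0 on, and its head is at position [z].
Comparing cells one by one makes the blanks that a tape happens to store
irrelevant. *)
Definition represents (w : seq bool) (t : tape void) (z : int) : Prop :=
  forall k : nat,
    nth None t.2 k = omap inl (bit_at w (z + k%:Z)%R) /\
    nth None t.1 k = omap inl (bit_at w (z - 1 - k%:Z)%R).

Definition has_written (t : tape void) (o : seq bool) : Prop :=
  t.1 = rev (bit_cells void o) /\ exists j, t.2 = nseq j None.

Lemma represents_move w t z m : represents w t z ->
  represents w (tape_move m (tape_write (tape_read t) t))
    (z + displacement m)%R.
Proof.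
move=> Ht; have [r0 l0] := Ht 0; rewrite addr0 subr0 in r0 l0.
case: t Ht r0 l0 => l r Ht r0 l0 k.
have [rk lk] := Ht k; have [rk1 lk1] := Ht k.+1; simpl in *.
have rE : nth None (head None r :: behead r) =1 nth None r.
  by move=> i; case: (r) i => [|x r'] [|i] //=; rewrite nth_nil.
case: m => /=.
- split; last first.
    have -> : (z - 1 - 1 - k%:Z = z - 1 - k.+1%:Z)%R by lia.
    by rewrite -lk1; case: (l) => [|x l'] //=; rewrite nth_nil.
  case: k rk lk rk1 lk1 => [|k] rk lk rk1 lk1.
    by rewrite addr0 /= -l0; case: (l).
  have -> : (z - 1 + k.+1%:Z = z + k%:Z)%R by lia.
  rewrite /= -/(nth None (head None r :: behead r) k) rE.
  by have [-> _] := Ht k.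
- by rewrite -/(nth None (head None r :: behead r) k) rE addr0.
- split.
    have -> : (z + 1 + k%:Z = z + k.+1%:Z)%R by lia.
    by rewrite -rk1 -(rE k.+1).
  rewrite addrK; case: k rk lk rk1 lk1 => [|k] rk lk rk1 lk1.
    by rewrite subr0 -r0; case: (r).
  have -> : (z - k.+1%:Z = z - 1 - k%:Z)%R by lia.
  by have [_ <-] := Ht k.
Qed.

Lemma represents_read w t z : represents w t z ->
  tape_read t = omap inl (bit_at w z).
Proof. by move=> /(_ 0) [+ _]; rewrite addr0 => <-; case: t => l []. Qed.

Lemma bit_of_read w t z : represents w t z ->
  bit_of (tape_read t) = bit_at w z.
Proof. by move=> /represents_read ->; case: bit_at. Qed.

Lemma has_written_stay t o : has_written t o ->
  has_written (tape_move Stay (tape_write (tape_read t) t)) o.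
Proof.
case: t => l r [/= -> [j ->]]; split=> //=; exists j.-1.+1.
by case: j.
Qed.

Lemma has_written_emit t o b : has_written t o ->
  has_written (tape_move MoveR (tape_write (Some (inl b)) t)) (o ++ [:: b]).
Proof.
case: t => l r [/= -> [j ->]]; split=> /=.
  by rewrite /bit_cells map_cat rev_cat.
by exists j.-1; case: j.
Qed.

Definition simulates (w : seq bool) (c : config compiled) (a : control P) :
    Prop :=
  [/\ c.1 = inr (a.1.1, a.1.2.1.2),
      forall h, represents w (c.2 (Some (Some (inl h)))) (a.1.2.1.1 h),
      forall x, represents w (c.2 (Some (Some (inr x)))) (a.2 x) &
      has_written (c.2 None) a.1.2.2].

Lemma simulates_step w c a :
  simulates w c a -> simulates w (step c) (control_step w a).
Proof.
case: c a => st ts [[g [[hp f] o]] cp] [/= -> Hh Hc Ho].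
rewrite /step /=; case: g => [q|] //=.
have -> : [ffun h => bit_of ([ffun i => tape_read (ts i)]
             (Some (Some (inl h))))] = reads w hp.
  by apply/ffunP => h; rewrite !ffunE (bit_of_read (Hh h)).
have -> : [ffun x => bit_of ([ffun i => tape_read (ts i)]
             (Some (Some (inr x))))] = reads w cp.
  by apply/ffunP => h; rewrite !ffunE (bit_of_read (Hc h)).
set r := next _ _ _ _; split=> //= [h|x|].
- by rewrite !ffunE /=; case: (emit r) => [b|]; apply: represents_move.
- by rewrite !ffunE /=; case: (emit r) => [b|]; apply: represents_move.
- rewrite !ffunE; case: (emit r) => [b|] /=.
    exact: has_written_emit.
  by rewrite cats0; apply: has_written_stay.
Qed.

Lemma represents_end w : represents w (rev (bit_cells void w), [::]) (size w).
Proof.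
move=> k; split=> /=.
  by rewrite nth_nil onth_default //; lia.
case: (ltnP k (size w)) => kw.
  have -> : ((size w)%:Z - 1 - k%:Z)%R = Posz (size w - k.+1) by lia.
  rewrite nth_rev size_map //= onthE.
  rewrite (nth_map true) ?(nth_map true) //; lia.
rewrite nth_default ?size_rev ?size_map //.
by have -> : ((size w)%:Z - 1 - k%:Z)%R = Negz (k - size w) by lia.
Qed.

Lemma copy_phase w k : k <= size w ->
  let c := iter k (@step compiled) (init compiled w) in
  [/\ c.1 = inl true,
      c.2 (Some None) = (rev (take k (bit_cells void w)),
                         drop k (bit_cells void w)),
      forall x, c.2 (Some (Some x)) = (rev (take k (bit_cells void w)), [::]) &
      has_written (c.2 None) [::]].
Proof.
elim: k => [|k IHk] kw.
  split=> [||x|]; rewrite //= !ffunE //=.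
  - by rewrite take0 drop0.
  - by rewrite take0.
  - by split=> //; exists 0.
have := IHk (ltnW kw); rewrite iterS.
case: (iter _ _ _) => st ts [/= -> Ei Ec Eo].
have kc : k < size (bit_cells void w) by rewrite size_map.
rewrite /step /= ffunE Ei (drop_nth None kc) /= {1}/tape_read /=.
rewrite (nth_map true) //=; split=> [||x|]; rewrite //= !ffunE /=.
- rewrite Ei (drop_nth None kc) /= (take_nth None kc) rev_rcons.
  by rewrite /tape_read /= (nth_map true).
- rewrite Ec /= /tape_write /= /tape_read /= (take_nth None kc) rev_rcons.
  by rewrite (nth_map true).
- exact: has_written_stay.
Qed.

(** The heads stand at position [k - 1]; after [k] moves they are at position
-1, and the last step returns them to the first bit. *)
Lemma rewind_phase w k (c : config compiled) : k <= size w ->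
  c.1 = inl false ->
  (forall x, represents w (c.2 (Some x)) (k%:Z - 1)%R) ->
  has_written (c.2 None) [::] ->
  simulates w (iter k.+1 (@step compiled) c)
    (Some (entry P), ([ffun=> 0%R], false, [::]), [ffun=> 0%R]).
Proof.
elim: k c => [|k IHk] c kw Es Er Ew.
  case: c Es Er Ew => st ts /= -> Er Ew; rewrite /step /= ffunE.
  rewrite (represents_read (Er None)) /=; split=> //= [h|x|].
  - rewrite !ffunE /=; exact: (represents_move MoveR (Er _)).
  - rewrite !ffunE /=; exact: (represents_move MoveR (Er _)).
  - rewrite !ffunE /=; exact: has_written_stay.
rewrite iterSr; case: c Es Er Ew => st ts /= -> Er Ew.
have E : (k.+1%:Z - 1 = k%:Z)%R by lia.
have S : step ((inl false, ts) : config compiled) = (inl false,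
   [ffun x => tape_move (input_moves MoveL x)
                (tape_write (tape_read (ts x)) (ts x))]).
  rewrite /step /= ffunE (represents_read (Er None)) E /= onthE.
  rewrite (nth_map true) //=; congr pair.
  by apply/ffunP => x; rewrite !ffunE.
rewrite S; apply: IHk => //=; first exact: ltnW.
- by move=> x; rewrite ffunE -E; apply: represents_move (Er _).
- rewrite ffunE; exact: has_written_stay.
Qed.

Lemma simulates_iter w t c a : simulates w c a ->
  simulates w (iter t (@step compiled) c) (iter t (control_step w) a).
Proof. by move=> S; elim: t => //= t; apply: simulates_step. Qed.

Lemma iter_step_halting (M : machine) t (c : config M) :
  halting c.1 -> iter t (@step M) c = c.
Proof. by move=> Hc; elim: t => //= t ->; rewrite /step Hc. Qed.

(** Copying takes [size w + 1] steps (the last one meets the blank after the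
word) and rewinding [size w + 1]; a halted machine keeps its output. *)
Theorem compiled_outputs w n rest o t : well_nested P ->
  w = nseq n true ++ false :: rest ->
  (exec w n P ([ffun=> 0%R], false, [::])).2 = o ->
  2 * size w + 2 + run_time n P <= t -> outputs_within compiled w t o.
Proof.
move=> WP wE oE tT.
have [Es Ei Ec Eo] := copy_phase (leqnn (size w)).
set c0 := iter (size w) _ _ in Es Ei Ec Eo *.
have Ei' x : c0.2 (Some x) = (rev (bit_cells void w), [::]).
  rewrite -(take_size (bit_cells void w)) size_map.
  case: x => [x|]; first exact: Ec.
  by rewrite Ei drop_oversize ?size_map.
have S : simulates w (iter (size w).+1 (@step compiled) (step c0))
    (Some (entry P), ([ffun=> 0%R], false, [::]), [ffun=> 0%R]).
  have R x : represents w (c0.2 (Some x)) (size w).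
    by rewrite Ei'; apply: represents_end.
  case: c0 Es Ei' Eo {Ei Ec} R => st ts /= -> Ei' Eo R.
  have -> : step ((inl true, ts) : config compiled) = (inl false,
   [ffun x => tape_move (input_moves MoveL x)
                (tape_write (tape_read (ts x)) (ts x))]).
    rewrite /step /= ffunE Ei' /=; congr pair.
    by apply/ffunP => x; rewrite !ffunE.
  apply: rewind_phase => //=.
  - by move=> x; rewrite ffunE; apply: represents_move.
  - rewrite ffunE; exact: has_written_stay.
have id_embeds : @embeds P P id.
  by move=> q; exists q => // f rh rc; rewrite /redirect; case: next.
have [] := control_exec wE ([ffun=> 0%R], false, [::]) id_embeds WP
  (cp := [ffun=> 0%R]); first by move=> c _; rewrite ffunE.
move=> t' lt' Et'.
have := simulates_iter t' S; rewrite Et' -iterSr -iterD.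
set k := t' + _; move=> Sk.
rewrite /outputs_within /=.
have {}Sk : simulates w (iter (k + size w) (@step compiled) (init compiled w))
    (None, exec w n P ([ffun=> 0%R], false, [::]), [ffun=> 0%R]).
  by rewrite iterD.
have kt : k + size w <= t by rewrite /k; move: lt' tT; lia.
rewrite -(subnK kt) iterD.
case: Sk => /= Es' _ _ [E1 [j E2]].
rewrite iter_step_halting /= ?Es' //; split=> //.
by exists 0, j; rewrite E1 revK E2 oE.
Qed.

Lemma poly_time_program (A B : problem) (f : instance A -> instance B) :
  well_nested P ->
  (forall x, exists n rest, encode x = nseq n true ++ false :: rest /\
     (exec (encode x) n P ([ffun=> 0%R], false, [::])).2 = encode (f x)) ->
  poly_time f.
Proof.
move=> WP HP; have [c [k Tck]] := run_time_poly P.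
exists compiled, (c + 4), k.+1 => x.
have [n [rest [wE oE]]] := HP x.
apply: (compiled_outputs WP wE oE).
set w := encode x in wE *.
have nw : n < size w by rewrite wE size_cat size_nseq /=; lia.
have Tn : run_time n P <= c * size w ^ k.
  apply: leq_trans (Tck n) _; rewrite leq_mul2l.
  by case: (k) => [|l]; rewrite ?expn0 ?orbT // leq_exp2r // nw orbT.
have : 0 < size w ^ k by rewrite expn_gt0 (leq_ltn_trans _ nw).
rewrite expnS; move: Tn nw; move: (size w ^ k) => u; nia.
Qed.

End Compile.
End Programs.

Arguments Move {H C}.
Arguments Act {H C}.

(** * Output of loop programs *)

Lemma flatten_iotaS (T : Type) (o : nat -> seq T) k :
  flatten [seq o i | i <- iota 0 k.+1]
    = flatten [seq o i | i <- iota 0 k] ++ o k.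
Proof. by rewrite -[k.+1]addn1 iotaD map_cat flatten_cat /= cats0. Qed.

Lemma map_const_iota (T : Type) (x : T) m k :
  [seq x | _ <- iota m k] = nseq k x.
Proof. by elim: k m => //= k IHk m; rewrite IHk. Qed.

Section Runs.

Variables (H C : finType) (w : seq bool) (n : nat).
Implicit Types (p q : program H C) (P Q R : {ffun H -> int}).

Definition runs p P f Q g (o : seq bool) : Prop :=
  forall out, exec w n p (P, f, out) = (Q, g, out ++ o).

(** The output does not depend on the flag found at the start; the final flag is
left open. *)
Definition writes p P Q o : Prop := forall f, exists g, runs p P f Q g o.

Lemma runs_then p q P f Q g R h o o' :
  runs p P f Q g o -> runs q Q g R h o' -> runs (Then p q) P f R h (o ++ o').
Proof. by move=> Hp Hq out; rewrite /= Hp Hq catA. Qed.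

Lemma runs_for c p (P : nat -> {ffun H -> int}) (f : nat -> bool)
    (o : nat -> seq bool) :
  (forall k, k < n -> runs p (P k) (f k) (P k.+1) (f k.+1) (o k)) ->
  runs (For c p) (P 0) (f 0) (P n) (f n) (flatten [seq o k | k <- iota 0 n]).
Proof.
move=> Hp out; suff: forall k, k <= n -> iter k (exec w n p) (P 0, f 0, out)
    = (P k, f k, out ++ flatten [seq o i | i <- iota 0 k]) by apply.
elim=> [|k IHk] kn; first by rewrite cats0.
by rewrite iterS IHk 1?ltnW // (Hp _ kn) flatten_iotaS catA.
Qed.

Lemma writes_then p q P Q R o o' :
  writes p P Q o -> writes q Q R o' -> writes (Then p q) P R (o ++ o').
Proof.
move=> Hp Hq f; have [g Hg] := Hp f; have [h Hh] := Hq g.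
by exists h; apply: runs_then Hg Hh.
Qed.

(** The invariant of the loop is the family [P] of head positions. *)
Lemma writes_for c p (P : nat -> {ffun H -> int}) (o : nat -> seq bool) :
  (forall k, k < n -> writes p (P k) (P k.+1) (o k)) ->
  writes (For c p) (P 0) (P n) (flatten [seq o k | k <- iota 0 n]).
Proof.
move=> Hp f; suff: forall k, k <= n -> exists g, forall out,
    iter k (exec w n p) (P 0, f, out)
      = (P k, g, out ++ flatten [seq o i | i <- iota 0 k]) by apply.
elim=> [|k IHk] kn; first by exists f => out; rewrite cats0.
have [g Hg] := IHk (ltnW kn); have [h Hh] := Hp _ kn g; exists h => out.
by rewrite iterS Hg Hh flatten_iotaS catA.
Qed.

Lemma writes_for_const c p P o : writes p P P o ->
  writes (For c p) P P (flatten (nseq n o)).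
Proof.
move=> Hp; have := @writes_for c p (fun=> P) (fun=> o) (fun _ _ => Hp).
by rewrite map_const_iota.
Qed.

Definition put (a : {ffun H -> option bool} -> bool) : program H C :=
  Act (fun f rd => (f, Some (a rd))).

Lemma writes_put a P : writes (put a) P P [:: a (reads w P)].
Proof. by move=> f; exists f => out. Qed.

Lemma writes_for_put c a P :
  writes (For c (put a)) P P (nseq n (a (reads w P))).
Proof.
have -> b : nseq n b = flatten (nseq n [:: b]) by elim: n => //= m <-.
exact: writes_for_const (writes_put a P).
Qed.

Fixpoint all_of (ps : seq (program H C)) : program H C :=
  if ps is p :: ps' then Then p (all_of ps')
  else Act (fun f _ => (f, None)).

Lemma writes_all_of (I : Type) (s : seq I) (p : I -> program H C) P o :
  (forall i, writes (p i) P P (o i)) ->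
  writes (all_of [seq p i | i <- s]) P P (flatten [seq o i | i <- s]).
Proof.
move=> Hp; elim: s => [|i s IHs] /=; last exact: writes_then.
by move=> f; exists f => out.
Qed.

End Runs.

Lemma poly_time_writes (H C : finType) (p : program H C) (A B : problem)
    (f : instance A -> instance B) : well_nested p ->
  (forall x, exists n rest Q, encode x = nseq n true ++ false :: rest /\
     writes (encode x) n p [ffun=> 0%R] Q (encode (f x))) ->
  poly_time f.
Proof.
move=> Wp Hp; apply: (poly_time_program Wp) => x.
have [n [rest [Q [E HQ]]]] := Hp x; have [g Hg] := HQ false.
by exists n, rest; split=> //; rewrite Hg.
Qed.

(** * Programs that only move heads *)

Section Travel.

Variables (h : nat) (C : finType) (w : seq bool) (n : nat).
Local Notation prog := (program 'I_h C).

Definition vec (l : seq int) : {ffun 'I_h -> int} :=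
  [ffun i => nth 0%R l (val i)].

Definition steer (l : seq move) : prog := Move (fun i : 'I_h => nth Stay l i).

Definition addl (l d : seq int) : seq int := [seq (p.1 + p.2)%R | p <- zip l d].

(** Displacements as lists, so that they compute on concrete programs and a
claim about head positions becomes a list of integer equations. *)
Definition travels (p : prog) (d : seq int) : Prop :=
  forall l f out, size l = size d ->
    exec w n p (vec l, f, out) = (vec (addl l d), f, out).

Lemma size_addl l d : size l = size d -> size (addl l d) = size d.
Proof. by move=> E; rewrite size_map size_zip E minnn. Qed.

Lemma travels_steer m : travels (steer m) (map displacement m).
Proof.
move=> l f out; rewrite size_map => E /=; congr (_, _, _); apply/ffunP => i.
rewrite !ffunE; case: (ltnP i (size m)) => im.
  rewrite (nth_map (0%R, 0%R)) ?size_zip ?size_map ?E ?minnn //.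
  by rewrite nth_zip ?size_map //= (nth_map Stay).
by rewrite !nth_default ?addr0 // ?size_map ?size_zip ?size_map ?E ?minnn.
Qed.

Lemma travels_then p q d e : size d = size e ->
  travels p d -> travels q e -> travels (Then p q) (addl d e).
Proof.
move=> E Hp Hq l f out; rewrite size_addl // => El /=.
rewrite Hp ?E // Hq ?size_addl ?E //; congr (vec _, _, _).
elim: l d e E El {Hp Hq} => [|x l IHl] [|y d] [|z e] //= [E] [El].
by rewrite /addl /= addrA; congr cons; apply: IHl.
Qed.

Lemma travels_for c p d : travels p d ->
  travels (For c p) [seq (x * n%:Z)%R | x <- d].
Proof.
move=> Hp l f out; rewrite size_map => El /=.
suff: forall m, iter m (exec w n p) (vec l, f, out)
  = (vec (addl l [seq (x * m%:Z)%R | x <- d]), f, out) by apply.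
elim=> [|m IHm] /=.
  congr (vec _, _, _); elim: l d El {Hp} => [|x l IHl] [|y d] //= [El].
  by rewrite /addl /= mulr0 addr0; congr cons; apply: IHl.
rewrite IHm Hp; last by rewrite size_addl ?size_map.
congr (vec _, _, _); elim: l d El {Hp IHm} => [|x l IHl] [|y d] //= [El].
by rewrite /addl /=; congr cons; [lia | apply: IHl].
Qed.

Lemma travels_to p d l l' f : travels p d -> size l = size d ->
  addl l d = l' -> runs w n p (vec l) f (vec l') f [::].
Proof. by move=> Hp E <- out; rewrite Hp // cats0. Qed.

Lemma travels_writes p d l l' : travels p d -> size l = size d ->
  addl l d = l' -> writes w n p (vec l) (vec l') [::].
Proof. by move=> Hp E El f; exists f; apply: travels_to El. Qed.

End Travel.

Lemma reads_vec (h : nat) w l (i : 'I_h) :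
  reads w (vec h l) i = bit_at w (nth 0%R l i).
Proof. by rewrite !ffunE. Qed.

(** * Bit matrices *)

Definition bit_matrix (n : nat) (a : nat -> nat -> bool) : seq bool :=
  [seq a i j | i <- iota 0 n, j <- iota 0 n].

Arguments bit_matrix : simpl never.

Lemma eq_matrix n a b : (forall i j, i < n -> j < n -> a i j = b i j) ->
  bit_matrix n a = bit_matrix n b.
Proof.
move=> E; congr flatten; apply/eq_in_map => i; rewrite mem_iota => Hi.
by apply/eq_in_map => j; rewrite mem_iota => Hj; apply: E.
Qed.

Lemma size_matrix n a : size (bit_matrix n a) = n * n.
Proof. by rewrite size_allpairs size_iota. Qed.

Lemma nth_matrix n a i j : i < n -> j < n ->
  nth false (bit_matrix n a) (i * n + j) = a i j.
Proof.
move=> Hi Hj; suff: forall r m k, k < r ->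
    nth false [seq a x y | x <- iota m r, y <- iota 0 n] (k * n + j)
      = a (m + k) j by apply.
elim=> // r IHr m [|k] Hk /=; rewrite nth_cat size_map size_iota.
  by rewrite Hj addn0 (nth_map 0) ?size_iota ?nth_iota.
rewrite ifF; last by apply/negbTE; nia.
by rewrite mulSn -addnA addKn IHr // addSnnS.
Qed.

Lemma matrix_ord n (a : 'I_n.+1 -> 'I_n.+1 -> bool) :
  [seq a x y | x <- enum 'I_n.+1, y <- enum 'I_n.+1]
    = bit_matrix n.+1 (fun i j => a (inord i) (inord j)).
Proof.
rewrite /bit_matrix -val_enum_ord; congr flatten; rewrite -map_comp.
apply/eq_map => x /=; rewrite -map_comp; apply/eq_map => y /=.
by rewrite !inord_val.
Qed.

(** The shape in which a program whose loops run [n] times writes a matrix with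
[n + 1] rows and columns. *)
Lemma matrixS n a : bit_matrix n.+1 a =
  flatten [seq [seq a i j | j <- iota 0 n] ++ [:: a i n] | i <- iota 0 n]
  ++ [seq a n j | j <- iota 0 n] ++ [:: a n n].
Proof.
rewrite /bit_matrix -[n.+1]addn1 iotaD map_cat flatten_cat /= cats0.
rewrite map_cat /=; congr (_ ++ _); congr flatten; apply/eq_map => i.
by rewrite map_cat.
Qed.

Lemma flatten_iota_blocks (T : Type) b n (F : nat -> seq T) :
  flatten [seq F v | v <- iota 0 (b * n)] =
  flatten [seq flatten [seq F (s * n + i) | i <- iota 0 n] | s <- iota 0 b].
Proof.
elim: b => [|b IHb] //; rewrite mulSnr iotaD map_cat flatten_cat IHb.
rewrite flatten_iotaS add0n -{1}[b * n]addn0 iotaDl -map_comp.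
by congr (_ ++ flatten _); apply/eq_map => i.
Qed.

Lemma iota_blocks b n :
  iota 0 (b * n) =
  flatten [seq [seq s * n + i | i <- iota 0 n] | s <- iota 0 b].
Proof.
rewrite -[LHS]flatten_seq1 flatten_iota_blocks; congr flatten.
by apply/eq_map => s; rewrite flatten_map1.
Qed.

(** The shape in which loops that run [n] times write a matrix of order [b * n]:
index [s * n + i] is element [i] of block [s]. *)
Lemma matrix_blocks b n (B : nat -> nat -> nat -> nat -> bool) :
  bit_matrix (b * n) (fun v u => B (v %/ n) (u %/ n) (v %% n) (u %% n)) =
  flatten [seq flatten [seq flatten [seq [seq B s t i j | j <- iota 0 n]
    | t <- iota 0 b] | i <- iota 0 n] | s <- iota 0 b].
Proof.
have divE s i : i < n -> (s * n + i) %/ n = s /\ (s * n + i) %% n = i.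
  move=> Hi; have n0 : 0 < n by apply: leq_ltn_trans Hi.
  by rewrite divnMDl // divn_small // addn0 modnMDl modn_small.
rewrite /bit_matrix flatten_iota_blocks; congr flatten; apply/eq_map => s.
congr flatten; apply/eq_in_map => i; rewrite mem_iota => /= Hi.
have [-> ->] := divE s i Hi.
rewrite -[LHS](map_id) -[LHS]flatten_seq1 -!map_comp flatten_iota_blocks.
congr flatten; apply/eq_map => t; rewrite -[RHS]flatten_seq1 -map_comp.
congr flatten; apply/eq_in_map => j; rewrite mem_iota => /= Hj.
by have [-> ->] := divE t j Hj.
Qed.

Lemma onth_matrix pre n a post i j : i < n -> j < n ->
  onth (pre ++ bit_matrix n a ++ post) (size pre + i * n + j) = Some (a i j).
Proof.
move=> Hi Hj; have Hij : i * n + j < n * n by nia.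
rewrite onthE (nth_map false); last by rewrite !size_cat size_matrix; lia.
rewrite nth_cat ifF; last by apply/negbTE; lia.
by rewrite -addnA addKn nth_cat size_matrix Hij nth_matrix.
Qed.

(** * Codes of structures and graphs *)

Definition binary3 : signature := @Signature 'I_3 (fun=> 2).

Definition sym0 : binary3 := @Ordinal 3 0 isT.
Definition sym1 : binary3 := @Ordinal 3 1 isT.
Definition sym2 : binary3 := @Ordinal 3 2 isT.

Definition entry_at (A : fin_structure binary3) (r : binary3)
    (i j : nat) : bool :=
  interp A r [tuple inord i; inord j].

Lemma encode_structureE (A : fin_structure binary3) (n := (dom_pred A).+1) :
  encode_structure A = nseq n true ++ false :: bit_matrix n (entry_at A sym0) ++
    bit_matrix n (entry_at A sym1) ++ bit_matrix n (entry_at A sym2).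
Proof.
rewrite /encode_structure -/n; congr (_ ++ _ :: _).
have -> : enum 'I_3 = [:: sym0; sym1; sym2].
  by apply: (inj_map val_inj); rewrite val_enum_ord.
have E r : [seq interp A r t | t <- lex_tuples (enum 'I_n) 2]
    = bit_matrix n (entry_at A r).
  have -> : bit_matrix n (entry_at A r) = _ :=
    esym (matrix_ord (fun x y => interp A r [tuple x; y])).
  rewrite /= map_flatten -map_comp; congr flatten; apply/eq_map => x /=.
  rewrite flatten_map1 -!map_comp; apply/eq_map => y /=.
  by congr interp; apply: val_inj.
by rewrite /= !E cats0.
Qed.

Definition adj_at (G : graph) (i j : nat) : bool :=
  [&& i < (vert_pred G).+1, j < (vert_pred G).+1 & @adj G (inord i) (inord j)].

Lemma encode_graphE (G : graph) (n := (vert_pred G).+1) :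
  encode_graph G = nseq n true ++ false :: bit_matrix n (adj_at G).
Proof.
rewrite /encode_graph matrix_ord; congr (_ ++ _ :: _).
by apply: eq_matrix => i j Hi Hj; rewrite /adj_at Hi Hj.
Qed.

Lemma size_encode_graph (G : graph) (n := (vert_pred G).+1) :
  size (encode_graph G) = n + 1 + n * n.
Proof.
rewrite encode_graphE -/n size_cat size_nseq.
by move: n (adj_at G) => k a; rewrite /= size_matrix -addn1; lia.
Qed.

Lemma bit_at_first n m a b i j : i < n -> j < n ->
  bit_at ((nseq n true ++ false :: bit_matrix n a) ++
          nseq m true ++ false :: bit_matrix m b) (Posz (n + 1 + (i * n + j)))
  = Some (a i j).
Proof.
move=> Hi Hj.
have := onth_matrix (nseq n true ++ [:: false]) a
  (nseq m true ++ false :: bit_matrix m b) Hi Hj.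
by rewrite size_cat size_nseq /= -!catA /= -addnA.
Qed.

Lemma bit_at_second n m a b i j : i < m -> j < m ->
  bit_at ((nseq n true ++ false :: bit_matrix n a) ++
          nseq m true ++ false :: bit_matrix m b)
    (Posz (n + 1 + n * n + m + 1 + (i * m + j)))
  = Some (b i j).
Proof.
move=> Hi Hj.
have := onth_matrix ((nseq n true ++ false :: bit_matrix n a) ++
  nseq m true ++ [:: false]) b [::] Hi Hj.
rewrite cats0 !size_cat !size_nseq /= size_matrix -!catA /= => <-.
by congr onth; lia.
Qed.

(** * Writing the structure of a pair of graphs *)

Definition counter0 : 'I_4 := @Ordinal 4 0 isT.
Definition counter1 : 'I_4 := @Ordinal 4 1 isT.
Definition counter2 : 'I_4 := @Ordinal 4 2 isT.
Definition counter3 : 'I_4 := @Ordinal 4 3 isT.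

Section GraphToStructure.

Variables (G H : graph).
Let n := (vert_pred G).+1.
Let m := (vert_pred H).+1.

(** Symbols 0, 1, 2 are E1, E2 and R'.  The point [n] is the new one; in the
last line the first disjunct makes R' full when the sizes differ. *)
Definition pinned_bit (r i j : nat) : bool :=
  match r with
  | 0 => adj_at G i j
  | 1 => (n == m) && adj_at H i j
  | _ => (n != m) || (i == n) && (j == n)
  end.

Definition pinned_structure : fin_structure binary3 :=
  @FinStructure binary3 n
    (fun r t => pinned_bit r (tnth (t : 2.-tuple _) ord0)
                             (tnth (t : 2.-tuple _) ord_max)).

Lemma encode_pinned_structure : encode_structure pinned_structure =
  nseq n.+1 true ++ false :: bit_matrix n.+1 (pinned_bit 0) ++
    bit_matrix n.+1 (pinned_bit 1) ++ bit_matrix n.+1 (pinned_bit 2).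
Proof.
rewrite encode_structureE; congr (_ ++ _ :: _).
by congr (_ ++ _); [|congr (_ ++ _)]; apply: eq_matrix => i j Hi Hj;
  rewrite /entry_at /= !(tnth_nth ord0) /= !inordK.
Qed.

Let w := encode_graph G ++ encode_graph H.

(** The code of the pair has length n * n + n + 1 + m * m + m + 1, hence
position 2 * n * n + 2 * n + 1 lies on the word iff n <= m, and the next one
lies off it iff m <= n. *)
Definition same_size (rd : {ffun 'I_4 -> option bool}) : bool :=
  (rd (@Ordinal 4 2 isT) != None) && (rd (@Ordinal 4 3 isT) == None).

Notation prog := (program 'I_4 'I_4).
Notation steer := (steer 4 'I_4).
Notation R := MoveR. Notation L := MoveL. Notation S := Stay.
Notation "p ;; q" := (Then p q) (at level 60, right associativity).

(** The last row and the last column are written outside the loops, as these run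
only over the [n] vertices of the first graph. *)
Definition square_program (a : {ffun 'I_4 -> option bool} -> bool)
    (mv : seq move) (border corner : {ffun 'I_4 -> option bool} -> bool) :
    prog :=
  For counter0 (For counter1 (put _ a ;; steer mv) ;; put _ border) ;;
  For counter1 (put _ border) ;; put _ corner.

Definition pinning_program : prog :=
  (For counter0 (put _ (fun=> true)) ;; put _ (fun=> true) ;;
   put _ (fun=> false)) ;;
  (For counter0 (steer [:: R; R; R; R]) ;; steer [:: R; R; R; R] ;;
   For counter0 (For counter1 (steer [:: S; R; R; R])) ;;
   For counter0 (steer [:: S; R; R; R]) ;; steer [:: S; R; R; R] ;;
   For counter0 (For counter1 (steer [:: S; S; R; R])) ;;
   steer [:: S; S; L; S]) ;;
  square_program (fun rd => rd (@Ordinal 4 0 isT) == Some true)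
    [:: R; S; S; S] (fun=> false) (fun=> false) ;;
  square_program
    (fun rd => same_size rd && (rd (@Ordinal 4 1 isT) == Some true))
    [:: S; R; S; S] (fun=> false) (fun=> false) ;;
  square_program (fun rd => ~~ same_size rd) [:: S; S; S; S]
    (fun rd => ~~ same_size rd) (fun=> true).

(** Heads 0 and 1 scan the two adjacency matrices; heads 2 and 3 stay at the
positions that decide whether the sizes agree.  The formula for head 1 is right
for equal sizes only, when its bits are used. *)
Definition pin_pos (a b : nat) : {ffun 'I_4 -> int} :=
  vec 4 [:: Posz (n + 1 + a); Posz (n * n + 2 * n + 2 + b);
            Posz (2 * (n * n) + 2 * n + 1); Posz (2 * (n * n) + 2 * n + 2)].

Let w_len : size w = n + 1 + n * n + m + 1 + m * m.
Proof.
by rewrite /w size_cat !size_encode_graph -/n -/m; lia.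
Qed.

Lemma same_size_pin_pos a b : same_size (reads w (pin_pos a b)) = (n == m).
Proof.
have onth_none k : (onth w k == None) = (size w <= k).
  by rewrite -onthNE; case: onth.
rewrite /same_size !reads_vec [nth _ _ _]/= [nth _ _ (Ordinal _)]/= /bit_at.
rewrite !onth_none w_len -ltnNge; apply/andP/eqP => [[]|<-]; nia.
Qed.

Lemma writes_square a mv border corner (P : nat -> {ffun 'I_4 -> int}) x :
  (forall k, writes w n (steer mv) (P k) (P k.+1) [::]) ->
  (forall i j, i < n -> j < n -> a (reads w (P (i * n + j))) = x i j) ->
  (forall i, i < n -> border (reads w (P (i.+1 * n))) = x i n) ->
  (forall j, j < n -> border (reads w (P (n * n))) = x n j) ->
  corner (reads w (P (n * n))) = x n n ->
  writes w n (square_program a mv border corner) (P 0) (P (n * n))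
    (bit_matrix n.+1 x).
Proof.
move=> Hmv Ha Hb1 Hb2 Hc; rewrite matrixS.
apply: writes_then.
  apply: (@writes_for _ _ w n counter0 _ (fun i => P (i * n))
     (fun i => [seq x i j | j <- iota 0 n] ++ [:: x i n])) => i Hi.
  apply: writes_then; last first.
    by rewrite -Hb1 //; apply: writes_put.
  have := @writes_for _ _ w n counter1 (put _ a ;; steer mv)
     (fun j => P (i * n + j))
     (fun j => [:: x i j]).
  rewrite addn0 -mulSnr flatten_map1; apply=> j Hj.
  rewrite -Ha // addnS.
  exact: writes_then (@writes_put _ _ _ _ a _) (Hmv _).
apply: writes_then; last by rewrite -Hc; apply: writes_put.
have -> : [seq x n j | j <- iota 0 n] = nseq n (border (reads w (P (n * n)))).
  rewrite -(map_const_iota _ 0); apply/eq_in_map => j.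
  by rewrite mem_iota => /= Hj; rewrite -Hb2.
exact: writes_for_put.
Qed.


Lemma writes_pinning : exists Q,
  writes w n pinning_program [ffun=> 0%R] Q (encode_structure pinned_structure).
Proof.
exists (pin_pos (n * n) (n * n)).
have -> : [ffun=> 0%R] = vec 4 [:: 0; 0; 0; 0]%R.
  by apply/ffunP => i; rewrite !ffunE; case: i => -[|[|[|[|]]]].
have -> : encode_structure pinned_structure =
    (nseq n true ++ [:: true] ++ [:: false]) ++ [::] ++
    bit_matrix n.+1 (pinned_bit 0) ++ bit_matrix n.+1 (pinned_bit 1) ++
    bit_matrix n.+1 (pinned_bit 2).
  have E : nseq n.+1 true = nseq n true ++ [:: true] by rewrite -addn1 nseqD.
  by rewrite encode_pinned_structure E -!catA.
apply: writes_then.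
  apply: writes_then; first exact: writes_for_put.
  by apply: writes_then; apply: writes_put.
apply: (@writes_then _ _ _ _ _ _ _ (pin_pos 0 0)).
  apply: travels_writes.
    by repeat
      (apply: travels_then || apply: travels_for || apply: travels_steer).
    by [].
  rewrite /addl /=; congr [:: _; _; _; _]; lia.
have wE := encode_graphE; have Hn : 0 < n by [].
apply: (@writes_then _ _ _ _ _ _ _ (pin_pos (n * n) 0)).
  apply: (@writes_square _ _ _ _ (fun k => pin_pos k 0)) => //.
  - move=> k; apply: travels_writes; [exact: travels_steer | by [] | ].
    rewrite /addl /=; congr [:: _; _; _; _]; lia.
  - move=> i j Hi Hj; rewrite reads_vec [nth _ _ _]/= /w !wE -/n -/m.
    by rewrite bit_at_first.
  - by move=> i Hi; rewrite /= /adj_at ltnn andbF.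
  - by move=> i Hi; rewrite /= /adj_at ltnn.
  - by rewrite /= /adj_at ltnn.
apply: (@writes_then _ _ _ _ _ _ _ (pin_pos (n * n) (n * n))).
  apply: (@writes_square _ _ _ _ (fun k => pin_pos (n * n) k)) => //.
  - move=> k; apply: travels_writes; [exact: travels_steer | by [] | ].
    rewrite /addl /=; congr [:: _; _; _; _]; lia.
  - move=> i j Hi Hj; rewrite same_size_pin_pos /=; case: eqP => //= E.
    rewrite reads_vec [nth _ _ _]/= /w !wE -/n -/m.
    rewrite -E; have -> : n * n + 2 * n + 2 + (i * n + j)
      = n + 1 + n * n + n + 1 + (i * n + j) by lia.
    by rewrite bit_at_second.
  - move=> i Hi; rewrite /=; case: eqP => //= E.
    by rewrite /adj_at -/m -E ltnn andbF.
  - by move=> i Hi; rewrite /=; case: eqP => //= E; rewrite /adj_at -/m -E ltnn.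
  - by rewrite /=; case: eqP => //= E; rewrite /adj_at -/m -E ltnn.
apply: (@writes_square _ _ _ _ (fun k => pin_pos (n * n) (n * n))) => //.
  - move=> k; apply: travels_writes; [exact: travels_steer | by [] | ].
    rewrite /addl /=; congr [:: _; _; _; _]; lia.
  - by move=> i j Hi Hj; rewrite same_size_pin_pos /= (ltn_eqF Hi) orbF.
  - by move=> i Hi; rewrite same_size_pin_pos /= (ltn_eqF Hi) orbF.
  - by move=> i Hi; rewrite same_size_pin_pos /= (ltn_eqF Hi) andbF orbF.
  - by rewrite /= eqxx orbT.
Qed.

End GraphToStructure.

Lemma pinning_poly_time (Psi : eso binary3) :
  @poly_time graph_isomorphism (eso_problem Psi)
    (fun p => pinned_structure p.1 p.2).
Proof.
apply: (@poly_time_writes _ _ pinning_program) => // -[G H].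
have [Q HQ] := writes_pinning G H.
exists (vert_pred G).+1,
  (bit_matrix (vert_pred G).+1 (adj_at G) ++ encode_graph H), Q; split=> //.
by rewrite [LHS](congr1 (cat^~ _) (encode_graphE G)) -catA.
Qed.

(** * Writing the two gadget graphs *)

(** Both graphs have six blocks of [n] vertices: block 0 is the domain, block 1
the labels, block 2 recognisable vertices p_0, p_1, and so on, and blocks 3, 4,
5 raise degrees.  Blocks 2 to 5 together form a clique, and label j
is joined to p_i iff j <= i.  The entry for vertex [i] of block [s] and vertex
[j] of block [t] depends on the comparisons [le] (i <= j) and [ge] (j <= i), the
entries [e], [e'] of E1 (on side 0) or E2 (on side 1) and [r], [r'] of R' at
(i, j) and (j, i), and on [ran]: whether j is in the range of R'. *)
Definition gadget_bit (side s t : nat) (le ge e e' r r' ran : bool) : bool :=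
  match s, t with
  | 0, 0 => ~~ (le && ge) && (e || e')
  | 0, 1 => if side == 0 then r else le && ge && ran
  | 1, 0 => if side == 0 then r' else le && ge && ran
  | 1, 2 => le
  | 2, 1 => ge
  | s'.+2, t'.+2 => ~~ ((s' == t') && (le && ge))
  | _, _ => false
  end.

Definition gadget_adj (m : nat -> nat -> nat -> bool) (n side s t i j : nat) :=
  gadget_bit side s t (i <= j) (j <= i) (m side i j) (m side j i)
    (m 2 i j) (m 2 j i) (has (fun a => m 2 a j) (iota 0 n)).

Section StructureToGraphs.

Notation prog := (program 'I_7 'I_4).
Notation steer := (steer 7 'I_4).
Notation R := MoveR. Notation L := MoveL. Notation S := Stay.
Notation "p ;; q" := (Then p q) (at level 60, right associativity).

Definition clear_flag : prog := Act (fun _ _ => (false, None)).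

Definition read_flag : prog :=
  Act (fun f rd => (f || (rd (@Ordinal 7 6 isT) == Some true), None)).

(** Head 6 walks down column [j] of R' while the flag collects the disjunction;
it is then moved back up. *)
Definition gadget_cell (side s t : nat) : prog :=
  clear_flag ;;
  For counter2 (read_flag ;; For counter3 (steer [:: S; S; S; S; S; S; R])) ;;
  For counter2 (For counter3 (steer [:: S; S; S; S; S; S; L])) ;;
  Act (fun f rd => (f, Some (gadget_bit side s t
    (rd (@Ordinal 7 4 isT) != None) (rd (@Ordinal 7 5 isT) != None)
    (rd (@Ordinal 7 0 isT) == Some true) (rd (@Ordinal 7 1 isT) == Some true)
    (rd (@Ordinal 7 2 isT) == Some true) (rd (@Ordinal 7 3 isT) == Some true)
    f))).

Definition next_column : prog :=
  steer [:: R; S; R; S; R; L; R] ;;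
  For counter3 (steer [:: S; R; S; R; S; S; S]).

Definition first_column : prog :=
  For counter1 (steer [:: L; S; L; S; L; R; L] ;;
          For counter3 (steer [:: S; L; S; L; S; S; S])).

Definition next_row : prog :=
  steer [:: S; R; S; R; L; R; S] ;;
  For counter3 (steer [:: R; S; R; S; S; S; S]).

Definition first_row : prog :=
  For counter0 (steer [:: S; L; S; L; R; L; S] ;;
          For counter3 (steer [:: L; S; L; S; S; S; S])).

Definition gadget_rows (side s : nat) : prog :=
  For counter0 (all_of
    [seq For counter1 (gadget_cell side s t ;; next_column) ;; first_column
    | t <- iota 0 6] ;; next_row) ;; first_row.

Definition gadget_graph_program (side : nat) : prog :=
  all_of [seq For counter0 (put _ (fun=> true)) | _ <- iota 0 6] ;;
  put _ (fun=> false) ;;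
  all_of [seq gadget_rows side s | s <- iota 0 6].

Definition gadget_program : prog :=
  (For counter0 (steer [:: R; R; R; R; S; S; R]) ;;
   steer [:: R; R; R; R; S; S; R] ;;
   For counter0 (For counter1
     (steer [:: S; S; R; R; S; S; R] ;; steer [:: S; S; R; R; S; S; R]))) ;;
  gadget_graph_program 0 ;;
  For counter0 (For counter1 (steer [:: R; R; S; S; S; S; S])) ;;
  gadget_graph_program 1.

Variables (n : nat) (m : nat -> nat -> nat -> bool).

Let w := nseq n true ++ false :: bit_matrix n (m 0) ++ bit_matrix n (m 1) ++
  bit_matrix n (m 2).

(** Heads 0 to 3 read E1 or E2 and R' at (i, j) and at the transposed position.
Heads 4 and 5 compare the indices: their positions j - i and i - j are less than
[n], so they lie on the word iff they are not negative. *)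
Definition gadget_pos (side i j a : nat) : {ffun 'I_7 -> int} :=
  vec 7 [:: Posz (n + 1 + side * (n * n) + (i * n + j));
            Posz (n + 1 + side * (n * n) + (j * n + i));
            Posz (n + 1 + 2 * (n * n) + (i * n + j));
            Posz (n + 1 + 2 * (n * n) + (j * n + i));
            (j%:Z - i%:Z)%R; (i%:Z - j%:Z)%R;
            Posz (n + 1 + 2 * (n * n) + (a * n + j))].

Ltac travel :=
  (apply: travels_writes || apply: travels_to);
  [ by repeat
      (apply: travels_then || apply: travels_for || apply: travels_steer)
  | by []
  | rewrite /addl /=; congr [:: _; _; _; _; _; _; _]; lia ].

Lemma bit_at_relation r i j : r < 3 -> i < n -> j < n ->
  bit_at w (Posz (n + 1 + r * (n * n) + (i * n + j))) = Some (m r i j).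
Proof.
move=> Hr Hi Hj.
pose pre := nseq n true ++ false ::
  flatten [seq bit_matrix n (m q) | q <- iota 0 r].
have Ep : size pre = n + 1 + r * (n * n).
  rewrite size_cat size_nseq /= -addnA add1n; congr (_ + _.+1).
  by case: r Hr {pre} => [|[|[|]]] // _;
    rewrite /= ?size_cat ?size_matrix ?cats0 /= ?size_cat ?size_matrix; lia.
rewrite -Ep addnA.
pose post := flatten [seq bit_matrix n (m q) | q <- iota r.+1 (2 - r)].
suff -> : w = pre ++ bit_matrix n (m r) ++ post by apply: onth_matrix.
by case: r Hr {Ep} @pre @post => [|[|[|]]] // _ pre post;
  rewrite /w /pre /post /= ?cats0 -!catA /= -?catA.
Qed.

Lemma some_eq_true b : (Some b == Some true) = b. Proof. by case: b. Qed.

Lemma bit_at_sub i j : i < n -> j < n ->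
  (bit_at w (j%:Z - i%:Z)%R != None) = (i <= j).
Proof.
move=> Hi Hj; case: leqP => ij.
  have -> : (j%:Z - i%:Z)%R = Posz (j - i) by lia.
  by rewrite (@bit_at_lt w n _ erefl) //; lia.
by have -> : (j%:Z - i%:Z)%R = Negz (i - j).-1 by lia.
Qed.

Lemma writes_gadget_cell side s t i j : side < 2 -> i < n -> j < n ->
  writes w n (gadget_cell side s t) (gadget_pos side i j 0)
    (gadget_pos side i j 0) [:: gadget_adj m n side s t i j].
Proof.
move=> Hs Hi Hj f; have Hs3 : side < 3 by lia.
exists (has (fun a => m 2 a j) (iota 0 n)).
rewrite -[[:: gadget_adj _ _ _ _ _ _ _]]cat0s.
apply: (@runs_then _ _ _ _ _ _ _ _ (gadget_pos side i j 0) false).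
  by move=> out.
rewrite -[[:: gadget_adj _ _ _ _ _ _ _]]cat0s.
apply: (@runs_then _ _ _ _ _ _ _ _ (gadget_pos side i j n)
    (has (fun a => m 2 a j) (iota 0 n))).
  have := @runs_for _ _ w n counter2
    (read_flag ;; For counter3 (steer [:: S; S; S; S; S; S; R]))
    (gadget_pos side i j) (fun k => has (fun a => m 2 a j) (iota 0 k))
    (fun=> [::]).
  rewrite [flatten _](_ : _ = [::]); last by elim: (iota 0 n).
  apply=> a Ha; apply: (@runs_then _ _ _ _ _ _ _ _ (gadget_pos side i j a)
      (has (fun a => m 2 a j) (iota 0 a.+1)) _ _ [::] [::]).
    have -> : has (fun a => m 2 a j) (iota 0 a.+1)
        = has (fun a => m 2 a j) (iota 0 a) || m 2 a j.
      by rewrite -[a.+1]addn1 iotaD has_cat /= orbF.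
    move=> out; rewrite /= reads_vec [nth _ _ _]/= (@bit_at_relation 2) //.
    by rewrite some_eq_true.
  travel.
rewrite -[[:: gadget_adj _ _ _ _ _ _ _]]cat0s.
apply: (@runs_then _ _ _ _ _ _ _ _ (gadget_pos side i j 0)).
  by travel.
move=> out; rewrite /= !reads_vec ![nth _ _ _]/=.
by rewrite !bit_at_relation // !bit_at_sub // !some_eq_true.
Qed.

Lemma writes_gadget_rows side s : side < 2 ->
  writes w n (gadget_rows side s)
    (gadget_pos side 0 0 0) (gadget_pos side 0 0 0)
    (flatten [seq flatten [seq [seq gadget_adj m n side s t i j | j <- iota 0 n]
      | t <- iota 0 6] | i <- iota 0 n]).
Proof.
move=> Hs; rewrite -[flatten _]cats0.
apply: (@writes_then _ _ _ _ _ _ _ (gadget_pos side n 0 0)); last by travel.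
apply: (@writes_for _ _ w n counter0 _
  (fun i => gadget_pos side i 0 0)) => i Hi.
rewrite -[flatten _]cats0.
apply: (@writes_then _ _ _ _ _ _ _ (gadget_pos side i 0 0)); last by travel.
apply: writes_all_of => t; rewrite -[map _ _]cats0.
apply: (@writes_then _ _ _ _ _ _ _ (gadget_pos side i n 0)); last by travel.
rewrite -flatten_map1.
apply: (@writes_for _ _ w n counter1 _
  (fun j => gadget_pos side i j 0)) => j Hj.
rewrite -[[:: _]]cats0; apply: writes_then; first exact: writes_gadget_cell.
by travel.
Qed.

Definition gadget_code (side : nat) : seq bool :=
  nseq (6 * n) true ++ false :: bit_matrix (6 * n) (fun v u =>
    gadget_adj m n side (v %/ n) (u %/ n) (v %% n) (u %% n)).

Lemma writes_gadget_graph side : side < 2 ->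
  writes w n (gadget_graph_program side) (gadget_pos side 0 0 0)
    (gadget_pos side 0 0 0) (gadget_code side).
Proof.
move=> Hs; rewrite /gadget_code matrix_blocks -cat1s.
apply: writes_then; last first.
  apply: writes_then; first exact: writes_put.
  by apply: writes_all_of => s; apply: writes_gadget_rows.
have -> : nseq (6 * n) true = flatten [seq nseq n true | _ <- iota 0 6].
  by rewrite /= cats0 !mulSn mul0n addn0 !nseqD.
by apply: writes_all_of => _; apply: writes_for_put.
Qed.

Lemma writes_gadgets : exists Q,
  writes w n gadget_program [ffun=> 0%R] Q (gadget_code 0 ++ gadget_code 1).
Proof.
exists (gadget_pos 1 0 0 0).
have -> : [ffun=> 0%R] = vec 7 [:: 0; 0; 0; 0; 0; 0; 0]%R.
  by apply/ffunP => i; rewrite !ffunE; case: i => -[|[|[|[|[|[|[|]]]]]]].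
rewrite -[_ ++ _]cat0s.
apply: (@writes_then _ _ _ _ _ _ _ (gadget_pos 0 0 0 0)).
  by travel.
apply: writes_then; first exact: writes_gadget_graph.
rewrite -[gadget_code 1]cat0s.
apply: (@writes_then _ _ _ _ _ _ _ (gadget_pos 1 0 0 0)).
  by travel.
exact: writes_gadget_graph.
Qed.

End StructureToGraphs.

(** * The extensional sentence *)

Definition binary1 : signature := @Signature unit (fun=> 2).

Definition input_atom (r : binary3) (x y : nat) :
    formula (sig_union binary3 binary1) :=
  @Rel (sig_union binary3 binary1) (inl r) [tuple x; y].

Definition map_atom (x y : nat) : formula (sig_union binary3 binary1) :=
  @Rel (sig_union binary3 binary1) (inr tt) [tuple x; y].

Definition edge_formula (r : binary3) (x y : nat) :=
  Or (input_atom r x y) (input_atom r y x).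

(** The first conjunct is the extensional one.  The map is onto because
an injective map of a finite domain to itself is. *)
Definition pinned_iso_formula : formula (sig_union binary3 binary1) :=
  And (foralls [:: 0; 1] (Imp (input_atom sym2 0 1) (map_atom 0 1)))
  (And (All 0 (Ex 1 (map_atom 0 1)))
  (And (foralls [:: 0; 1; 2]
         (Imp (And (map_atom 0 1) (map_atom 0 2)) (Eq 1 2)))
  (And (foralls [:: 0; 1; 2]
         (Imp (And (map_atom 0 2) (map_atom 1 2)) (Eq 0 1)))
       (foralls [:: 0; 1; 2; 3]
         (Imp (And (map_atom 0 2) (map_atom 1 3)) (Imp (Not (Eq 0 1))
           (And (Imp (edge_formula sym0 0 1) (edge_formula sym1 2 3))
                (Imp (edge_formula sym1 2 3) (edge_formula sym0 0 1))))))))).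

Definition pinned_iso_sentence : eso binary3 :=
  @Eso binary3 binary1 pinned_iso_formula erefl.

Lemma extensional_pinned_iso_sentence : extensional pinned_iso_sentence.
Proof.
exists (fun=> sym2); split=> [[] []|[]] //; split=> //.
by exists [tuple 0; 1], [tuple 0; 1]; split=> //; right; left; left.
Qed.

Definition rel_at (A : fin_structure binary3) (r : binary3)
    (x y : 'I_(dom_pred A).+1) : bool :=
  interp A r [tuple x; y].
Arguments rel_at : clear implicits.

(** Every relation gives an edge relation in this way, so that the sentence need
not require E1 and E2 to be symmetric. *)
Definition edge_at A r x y := rel_at A r x y || rel_at A r y x.
Arguments edge_at : clear implicits.

Definition pinned_iso (A : fin_structure binary3)
    (f : 'I_(dom_pred A).+1 -> 'I_(dom_pred A).+1) : Prop :=
  [/\ injective f,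
      forall x y, rel_at A sym2 x y -> f x = y &
      forall x y, x != y -> edge_at A sym1 (f x) (f y) = edge_at A sym0 x y].

Lemma sat_input_atom A B v r x y :
  sat (expand (interp A) B) v (input_atom r x y) <-> rel_at A r (v x) (v y).
Proof.
suff -> : sat (expand (interp A) B) v (input_atom r x y)
  = rel_at A r (v x) (v y) by [].
by rewrite /= /rel_at; congr (is_true (_ _)); apply: val_inj.
Qed.

Lemma sat_map_atom D (A : structure binary3 D) (B : structure binary1 D) v x y :
  sat (expand A B) v (map_atom x y) <-> B tt [tuple v x; v y].
Proof.
suff -> : sat (expand A B) v (map_atom x y) = B tt [tuple v x; v y] by [].
by rewrite /=; congr (is_true (_ _)); apply: val_inj.
Qed.

(** A predicate that satisfies the sentence is the graph of a function, and
conversely the graph of a function is a witness. *)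
Lemma eso_models_pinned_iso A :
  eso_models (interp A) pinned_iso_sentence <-> exists f, @pinned_iso A f.
Proof.
pose n := (dom_pred A).+1.
have satE (B : structure binary1 'I_n) (v : nat -> 'I_n) :
  let F x y := B tt [tuple x; y] in
  sat (expand (interp A) B) v pinned_iso_formula <->
  [/\ forall x y, rel_at A sym2 x y -> F x y,
      forall x, exists y, F x y,
      forall x y z, F x y /\ F x z -> y = z,
      forall x y z, F x z /\ F y z -> x = y &
      forall x y z t, F x z /\ F y t -> x <> y ->
        (rel_at A sym0 x y \/ rel_at A sym0 y x ->
         rel_at A sym1 z t \/ rel_at A sym1 t z) /\
        (rel_at A sym1 z t \/ rel_at A sym1 t z ->
         rel_at A sym0 x y \/ rel_at A sym0 y x)].
  (* The atoms are kept folded while the quantifiers and valuations compute. *)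
  move=> F; rewrite /pinned_iso_formula /foralls /foldr /edge_formula.
  cbn -[input_atom map_atom].
  setoid_rewrite sat_input_atom; setoid_rewrite sat_map_atom; cbn -[rel_at].
  split=> [[H1 [H2 [H3 [H4 H5]]]]|[H1 H2 H3 H4 H5]]; first by split.
  by do 4 split=> //.
split=> [[B HB]|[f [f_inj Hpin Hedge]]]; last first.
  pose B : structure binary1 'I_n := fun _ t =>
    f (tnth (t : 2.-tuple _) ord0) == tnth (t : 2.-tuple _) ord_max.
  have BE x y : B tt [tuple x; y] = (f x == y) by rewrite /B !(tnth_nth x).
  exists B => v; apply/satE; split.
  - by move=> x y /Hpin <-; rewrite BE.
  - by move=> x; exists (f x); rewrite BE.
  - by move=> x y z; rewrite !BE => -[/eqP <- /eqP <-].
  - by move=> x y z; rewrite !BE => -[/eqP <- /eqP] /f_inj.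
  - move=> x y z t; rewrite !BE => -[/eqP <- /eqP <-] /eqP/Hedge.
    rewrite /edge_at => E.
    by split=> /orP H; apply/orP; rewrite E || rewrite -E.
have /satE [Hpin Htot Hfun Hinj Hedge] := HB (fun=> ord0).
pose F x y := B tt [tuple x; y].
have /fin_all_exists [f Hf] : forall x, exists y, F x y by exact: Htot.
exists f; split=> [x y E|x y /Hpin Fxy|x y /eqP xy].
- by apply: (Hinj _ _ (f y)); split; last exact: Hf; rewrite -E; apply: Hf.
- by apply: (Hfun x); split; first exact: Hf.
- have [] := Hedge x y (f x) (f y) (conj (Hf x) (Hf y)) xy.
  by rewrite /edge_at => E1 E2; apply/orP/orP.
Qed.

(** * Graph isomorphism with one pinned point *)

Lemma adj_at_sym G i j : adj_at G i j = adj_at G j i.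
Proof. by rewrite /adj_at adj_sym; case: (i < _); case: (j < _). Qed.

Lemma adj_at_ord G (x y : 'I_(vert_pred G).+1) : adj_at G x y = adj x y.
Proof. by rewrite /adj_at !ltn_ord !inord_val. Qed.

Lemma adj_at_default G i j : vert_pred G < i -> adj_at G i j = false.
Proof. by move=> Hi; rewrite /adj_at [i < _]ltnNge Hi. Qed.

Lemma rel_at_pinned G H r x y :
  rel_at (pinned_structure G H) r x y = pinned_bit G H r x y.
Proof. by rewrite /rel_at /= !(tnth_nth ord0). Qed.

Lemma edge_at_pinned0 G H x y :
  edge_at (pinned_structure G H) sym0 x y = adj_at G x y.
Proof. by rewrite /edge_at !rel_at_pinned /= (adj_at_sym _ y) orbb. Qed.

Lemma edge_at_pinned1 G H x y :
  edge_at (pinned_structure G H) sym1 x y =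
    (vert_pred G == vert_pred H) && adj_at H x y.
Proof.
by rewrite /edge_at !rel_at_pinned /= (adj_at_sym _ y) orbb.
Qed.

(** The isomorphism is extended by fixing the new point, which is isolated in
both graphs of the structure. *)
Lemma isomorphic_pinned_iso G H : isomorphic G H ->
  exists f, @pinned_iso (pinned_structure G H) f.
Proof.
case=> g [g_bij g_adj]; pose n := (vert_pred G).+1.
have nm : vert_pred G = vert_pred H.
  by apply: succn_inj; rewrite -[LHS]card_ord (bij_eq_card g_bij) card_ord.
have nmE : vert_pred G == vert_pred H by apply/eqP.
pose h x := if x < n then g (inord x) : nat else n.
have h_le x : h x < n.+1.
  rewrite /h; case: ifP => // _; apply: leqW.
  by rewrite (leq_trans (ltn_ord _)) // /n nm.
pose f (x : 'I_n.+1) : 'I_n.+1 := inord (h x).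
have fE x : f x = h x :> nat by rewrite inordK.
have hn x : n <= x -> h x = n by rewrite /h ltnNge => ->.
have hlt x (Hx : x < n) : h x = g (inord x) by rewrite /h Hx.
have h_out x : vert_pred H < h x = (n <= x).
  case: (leqP n x) => Hx; first by rewrite hn // /n nm leqnn.
  by rewrite hlt // ltnNge -ltnS ltn_ord.
have f_inj : injective f.
  move=> x y /(congr1 (@nat_of_ord _)); rewrite !fE => E; apply: val_inj => /=.
  have := h_out x; rewrite E h_out; case: (leqP n x) => [nx|xn] ny.
    have Hx : x < n.+1 := ltn_ord x; have Hy : y < n.+1 := ltn_ord y; lia.
  have yn : y < n by lia.
  move: E; rewrite !hlt // => /val_inj/(bij_inj g_bij)/(congr1 (@nat_of_ord _)).
  by rewrite !inordK.
have f_pin (x y : 'I_n.+1) : pinned_bit G H 2 x y -> f x = y.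
  rewrite /= eqSS nmE /= => /andP[/eqP Ex /eqP Ey].
  by apply: val_inj; rewrite /= fE hn ?Ex ?Ey.
have f_edge (x y : 'I_n.+1) : adj_at H (f x) (f y) = adj_at G x y.
  rewrite !fE; case: (leqP n x) => nx.
    by rewrite !adj_at_default // h_out.
  case: (leqP n y) => ny.
    by rewrite adj_at_sym (adj_at_sym G) !adj_at_default // h_out.
  by rewrite !hlt // adj_at_ord g_adj -adj_at_ord !inordK.
exists f; split=> [|x y|x y _]; first exact: f_inj.
  by rewrite rel_at_pinned; apply: f_pin.
by rewrite edge_at_pinned0 edge_at_pinned1 nmE; apply: f_edge.
Qed.

(** A full R' would send the first point to every point, so the sizes agree;
then the new point is fixed and the rest is an isomorphism of the graphs. *)
Lemma pinned_iso_isomorphic G H f : @pinned_iso (pinned_structure G H) f ->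
  isomorphic G H.
Proof.
case=> f_inj f_pin f_edge; pose n := (vert_pred G).+1.
have nm : vert_pred G = vert_pred H.
  apply/eqP/negPn/negP => nm.
  have E y : f ord0 = y by apply: f_pin; rewrite rel_at_pinned /= eqSS nm.
  by have := E ord0; rewrite (E ord_max).
have nmE : vert_pred G == vert_pred H by apply/eqP.
have f_max : f ord_max = ord_max.
  by apply: f_pin; rewrite rel_at_pinned /= !eqxx orbT.
pose g (x : 'I_n) : 'I_(vert_pred H).+1 := inord (f (inord x)).
have xE (x : 'I_n) : (inord x : 'I_n.+1) = x :> nat.
  by rewrite inordK // leqW.
have gE x : g x = f (inord x) :> nat.
  rewrite inordK // -nm; have := ltn_ord (f (inord x)).
  rewrite ltnS leq_eqVlt => /orP[/eqP E|//].
  have /f_inj/(congr1 val) : f (inord x) = f ord_max.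
    by rewrite f_max; apply: val_inj.
  by rewrite /= xE => E'; have := ltn_ord x; rewrite E' ltnn.
have g_inj : injective g.
  move=> x y /(congr1 val); rewrite /= !gE => /val_inj/f_inj/(congr1 val).
  by rewrite /= !xE => /val_inj.
exists g; split; first by apply: inj_card_bij => //; rewrite !card_ord nm.
move=> x y; case: (eqVneq x y) => [->|xy]; first by rewrite !adj_irr.
rewrite -!adj_at_ord !gE.
have /f_edge : (inord x : 'I_n.+1) != inord y.
  by apply: contra xy => /eqP/(congr1 val) /=; rewrite !xE => /val_inj ->.
by rewrite edge_at_pinned0 edge_at_pinned1 nmE /= !xE.
Qed.

(** * Degrees in the gadget graphs *)

Lemma count_leq k i : i < k -> count (fun j => j <= i) (iota 0 k) = i.+1.
Proof.
move=> Hi; rewrite -(subnKC Hi) iotaD count_cat add0n.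
rewrite [X in _ + X](eq_in_count (a2 := pred0)); last first.
  by move=> j; rewrite mem_iota /= => /andP[H _]; apply/negbTE; rewrite -ltnNge.
rewrite count_pred0 addn0 (eq_in_count (a2 := predT)).
  by rewrite count_predT size_iota.
by move=> j; rewrite mem_iota.
Qed.

Lemma count_neq k i : i < k ->
  count (fun j => ~~ ((i <= j) && (j <= i))) (iota 0 k) = k.-1.
Proof.
move=> Hi; have := count_predC (pred1 i) (iota 0 k).
rewrite count_uniq_mem ?iota_uniq // mem_iota /= Hi size_iota.
rewrite (eq_count (a2 := fun j => ~~ ((i <= j) && (j <= i)))); first by lia.
by move=> j /=; rewrite -eqn_leq eq_sym.
Qed.


Lemma gadget_adj_label m k i j : gadget_adj m k 1 0 1 i j =
  (i == j) && has (fun a => m 2 a j) (iota 0 k).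
Proof. by rewrite /gadget_adj /= -eqn_leq. Qed.

Section BlockDegree.

Variables (m : nat -> nat -> nat -> bool) (k side : nat).

Definition block_degree s t i : nat :=
  count (gadget_adj m k side s t i) (iota 0 k).

Lemma block_degree_le s t i : block_degree s t i <= k.
Proof.
have := count_size (gadget_adj m k side s t i) (iota 0 k).
by rewrite size_iota.
Qed.

Lemma block_degree0 s t i :
  (forall j, gadget_adj m k side s t i j = false) -> block_degree s t i = 0.
Proof. by move=> E; rewrite /block_degree (eq_count E) count_pred0. Qed.

Lemma block_degreeT s t i :
  (forall j, gadget_adj m k side s t i j) -> block_degree s t i = k.
Proof.
by move=> E; rewrite /block_degree (eq_count E) count_predT size_iota.
Qed.

Definition vertex_degree s i : nat :=
  block_degree s 0 i + block_degree s 1 i + block_degree s 2 i +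
  block_degree s 3 i + block_degree s 4 i + block_degree s 5 i.

(** A vertex of the domain or a label has neighbours in two blocks only.  The
bound 2 * k is less than 4 * k - 1, the least degree in the clique, if k > 0. *)
Lemma vertex_degree_low s i : s < 2 -> vertex_degree s i <= 2 * k.
Proof.
have le := block_degree_le; rewrite /vertex_degree.
case: s => [|[|]] // _.
  have := le 0 0 i; have := le 0 1 i.
  by rewrite !(@block_degree0 0 _.+2) //; lia.
have := le 1 0 i; have := le 1 2 i.
by rewrite (@block_degree0 1 1) // !(@block_degree0 1 _.+3) //; lia.
Qed.

Lemma block_degree_diag s i : i < k -> block_degree s.+2 s.+2 i = k.-1.
Proof.
move=> Hi; rewrite -(count_neq Hi); apply: eq_count => j.
by rewrite /gadget_adj; case: s => [|s] /=; rewrite ?eqxx.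
Qed.

(** The i + 1 labels up to i and the other 4 * k - 1 vertices
of the clique are the neighbours. *)
Lemma vertex_degree_anchor i : i < k -> vertex_degree 2 i = 4 * k + i.
Proof.
move=> Hi; rewrite /vertex_degree block_degree_diag //.
rewrite !(@block_degreeT 2 _.+3) // (@block_degree0 2 0) //.
have -> : block_degree 2 1 i = i.+1 by apply: count_leq.
lia.
Qed.

Lemma vertex_degree_clique s i : 2 < s < 6 -> i < k ->
  vertex_degree s i = (4 * k).-1.
Proof.
move=> Hs Hi; rewrite /vertex_degree.
case: s Hs => [|[|[|[|[|[|]]]]]] // _;
  rewrite !(@block_degree0 _ 0) ?(@block_degree0 _ 1) //;
  rewrite block_degree_diag // !block_degreeT //; lia.
Qed.

End BlockDegree.

(** * Isomorphisms of the gadget graphs *)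

Section GadgetGraph.

Variables (d : nat) (m : nat -> nat -> nat -> bool).
Let n := d.+1.

Lemma gadget_adj_sym side s t i j :
  gadget_adj m n side s t i j = gadget_adj m n side t s j i.
Proof.
rewrite /gadget_adj.
case: s t => [|[|[|s]]] [|[|[|t]]] //=.
- by rewrite [m side i j || _]orbC [(i <= j) && _]andbC.
- by case: (side == 0) => //; rewrite -!andbA; case: (ltngtP i j) => //= ->.
- by case: (side == 0) => //; rewrite -!andbA; case: (ltngtP i j) => //= ->.
- by rewrite andbC.
- by rewrite [s.+1 == _]eq_sym [(j <= i) && _]andbC.
Qed.

Lemma gadget_adj_irr side s i : gadget_adj m n side s s i i = false.
Proof.
by rewrite /gadget_adj leqnn; case: s => [|[|[|s]]] //=; rewrite eqxx.
Qed.

Definition gadget_graph (side : nat) : graph :=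
  @Graph (6 * d + 5)
    (fun v u => gadget_adj m n side (v %/ n) (u %/ n) (v %% n) (u %% n))
    (fun v u => gadget_adj_sym _ _ _ _ _)
    (fun v => gadget_adj_irr _ _ _).

Lemma order_gadget : (6 * d + 5).+1 = 6 * n. Proof. by rewrite /n; lia. Qed.

Lemma encode_gadget_graph side :
  encode_graph (gadget_graph side) = gadget_code n m side.
Proof.
rewrite encode_graphE /gadget_code -order_gadget.
congr (_ ++ _ :: _); apply: eq_matrix => v u Hv Hu.
by rewrite /adj_at Hv Hu /= !inordK.
Qed.

Notation V := 'I_(6 * d + 5).+1.

Definition vertex (s i : nat) : V := inord (s * n + i).

Lemma vertex_inj_code s i : s < 6 -> i < n ->
  vertex s i %/ n = s /\ vertex s i %% n = i.
Proof.
move=> Hs Hi; rewrite /vertex inordK; last by rewrite order_gadget; nia.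
by rewrite divnMDl // divn_small // addn0 modnMDl modn_small.
Qed.

(** Case analysis of a vertex into its block and its index there. *)
Variant vertex_spec : V -> Type :=
  VertexSpec s i of s < 6 & i < n : vertex_spec (vertex s i).

Lemma vertexP (v : V) : vertex_spec v.
Proof.
have -> : v = vertex (v %/ n) (v %% n).
  by apply: val_inj; rewrite /= /vertex -divn_eq inord_val.
split; last by rewrite ltn_mod.
by rewrite ltn_divLR // -order_gadget.
Qed.

Lemma adj_vertex side s t i j : s < 6 -> t < 6 -> i < n -> j < n ->
  @adj (gadget_graph side) (vertex s i) (vertex t j)
    = gadget_adj m n side s t i j.
Proof.
move=> Hs Ht Hi Hj /=.
have [-> ->] := vertex_inj_code Hs Hi.
by have [-> ->] := vertex_inj_code Ht Hj.
Qed.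

Lemma eq_vertex s t i j : s < 6 -> t < 6 -> i < n -> j < n ->
  vertex s i = vertex t j -> s = t /\ i = j.
Proof.
move=> Hs Ht Hi Hj E; have := vertex_inj_code Hs Hi.
by rewrite E; have [-> ->] := vertex_inj_code Ht Hj; case=> -> ->.
Qed.

Definition degree (G : graph) (x : 'I_(vert_pred G).+1) : nat :=
  #|[pred u | adj x u]|.

Lemma degree_vertex side s i : s < 6 -> i < n ->
  @degree (gadget_graph side) (vertex s i) = vertex_degree m n side s i.
Proof.
move=> Hs Hi; rewrite /degree cardE size_filter -enumT [X in count X _]/=.
have [-> ->] := vertex_inj_code Hs Hi.
rewrite -(count_map (@nat_of_ord _)
  (fun u => gadget_adj m n side s (u %/ n) i (u %% n))).
rewrite val_enum_ord order_gadget iota_blocks count_flatten -map_comp.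
have -> : [seq count (fun u => gadget_adj m n side s (u %/ n) i (u %% n))
    [seq t * n + j | j <- iota 0 n] | t <- iota 0 6]
  = [seq block_degree m n side s t i | t <- iota 0 6].
  apply/eq_map => t; rewrite count_map; apply: eq_in_count => j.
  rewrite mem_iota => /= Hj; rewrite divnMDl // divn_small // addn0.
  by rewrite modnMDl modn_small.
by rewrite /vertex_degree /= addn0 !addnA.
Qed.

Lemma degree_iso (G H : graph) g x : bijective g ->
  (forall x y, @adj H (g x) (g y) = @adj G x y) ->
  @degree H (g x) = @degree G x.
Proof.
move=> g_bij g_adj; rewrite /degree -!sum1_card (reindex g) /=.
  by apply: eq_bigl => u; rewrite !inE g_adj.
exact: onW_bij.
Qed.

Notation G0 := (gadget_graph 0).
Notation G1 := (gadget_graph 1).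

(** The condition [pinned_iso], for relations given on natural numbers. *)
Definition pinned_map (f : 'I_n -> 'I_n) : Prop :=
  [/\ injective f,
      forall x y : 'I_n, m 2 x y -> f x = y &
      forall x y, x != y ->
        m 1 (f x) (f y) || m 1 (f y) (f x) = m 0 x y || m 0 y x].

(** The degree 4 * n + i belongs to p_i only, so every p_i is fixed.  Domain
vertices and labels are the vertices of degree at most 2 * n; among them the
labels are those adjacent to p_(n-1), and label i is determined by being
adjacent to p_k exactly for k >= i.  Hence the labels are fixed and the domain
is mapped to itself. *)
Lemma gadget_isomorphic_pinned_map :
  isomorphic G0 G1 -> exists f, pinned_map f.
Proof.
case=> g [g_bij g_adj].
have deg_g t j s i : g (vertex s i) = vertex t j -> s < 6 -> i < n ->
    t < 6 -> j < n -> vertex_degree m n 1 t j = vertex_degree m n 0 s i.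
  move=> E Hs Hi Ht Hj; rewrite -!degree_vertex // -E.
  exact: degree_iso.
have high t j side : t < 6 -> j < n ->
    vertex_degree m n side t j <= 2 * n -> t < 2.
  move=> Ht Hj; rewrite leqNgt; apply: contraR; rewrite -leqNgt => t2.
  case: (ltngtP t 2) t2 => // [t3|->] _; last first.
    by rewrite vertex_degree_anchor //; lia.
  by rewrite vertex_degree_clique ?t3 //; lia.
have g_anchor i : i < n -> g (vertex 2 i) = vertex 2 i.
  move=> Hi; case E: (g _) / (vertexP (g (vertex 2 i))) => [t j Ht Hj].
  have := deg_g t j 2 i E isT Hi Ht Hj; rewrite vertex_degree_anchor //.
  case: (ltngtP t 2) => [t2|t3|->].
  - by have := vertex_degree_low m n 1 j t2; lia.
  - by rewrite vertex_degree_clique ?t3 //; lia.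
  - by rewrite vertex_degree_anchor // => /addnI ->.
have adj_anchor s i t j k : s < 6 -> i < n -> t < 6 -> j < n -> k < n ->
    g (vertex s i) = vertex t j ->
    gadget_adj m n 1 t 2 j k = gadget_adj m n 0 s 2 i k.
  move=> Hs Hi Ht Hj Hk E; have := g_adj (vertex s i) (vertex 2 k).
  by rewrite E g_anchor // !adj_vertex.
have g_label i : i < n -> g (vertex 1 i) = vertex 1 i.
  move=> Hi; case E: (g _) / (vertexP (g (vertex 1 i))) => [t j Ht Hj].
  have t2 : t < 2.
    apply: (@high t j 1) => //.
    by rewrite (deg_g _ _ _ _ E) // vertex_degree_low.
  have A k (Hk : k < n) := adj_anchor 1 i t j k isT Hi Ht Hj Hk E.
  case: t t2 Ht A {E} => [|[|]] // _ _ A.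
    by have := A i Hi; rewrite /gadget_adj /= leqnn.
  have := A i Hi; have := A j Hj; rewrite /gadget_adj /= !leqnn => ij ji.
  by congr vertex; apply/eqP; rewrite eqn_leq ji -ij.
have g_base i : i < n -> exists2 j, j < n & g (vertex 0 i) = vertex 0 j.
  move=> Hi; case E: (g _) / (vertexP (g (vertex 0 i))) => [t j Ht Hj].
  have t2 : t < 2.
    apply: (@high t j 1) => //.
    by rewrite (deg_g _ _ _ _ E) // vertex_degree_low.
  case: t t2 Ht E => [|[|]] // _ _ E; first by exists j.
  have := adj_anchor 0 i 1 j j isT Hi isT Hj Hj E.
  by rewrite /gadget_adj /= leqnn.
have /fin_all_exists [f fE] : forall i : 'I_n, exists j : 'I_n,
    g (vertex 0 i) = vertex 0 j.
  by move=> i; have [j Hj E] := g_base i (ltn_ord i); exists (Ordinal Hj).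
exists f; split=> [x y E|x y xy|x y xy].
- have /(bij_inj g_bij) : g (vertex 0 x) = g (vertex 0 y) by rewrite !fE E.
  by case/eq_vertex=> // _ /val_inj.
- (* An edge from x to label y becomes one from f x to label y, and on side 1
     such an edge forces f x = y. *)
  have := g_adj (vertex 0 x) (vertex 1 y).
  rewrite fE g_label // !adj_vertex // /gadget_adj /= xy -andbA.
  case/and3P=> fxy yfx _.
  by apply: val_inj; apply/eqP; rewrite eqn_leq fxy.
- have fxy : f x != f y.
    apply: contra xy => /eqP E.
    have /(bij_inj g_bij) : g (vertex 0 x) = g (vertex 0 y) by rewrite !fE E.
    by case/eq_vertex=> // _ /val_inj ->.
  have := g_adj (vertex 0 x) (vertex 0 y).
  rewrite !fE !adj_vertex // /gadget_adj /= -!eqn_leq.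
  by move: xy fxy; rewrite -!val_eqE /= => -> ->.
Qed.

(** The map acts on block 0 and is the identity elsewhere.  Label edges are
preserved because injectivity makes i the only element that R' can relate
to its image. *)
Lemma pinned_map_gadget_isomorphic f : pinned_map f -> isomorphic G0 G1.
Proof.
case=> f_inj f_pin f_edge.
pose g (v : V) : V := if v %/ n == 0 then vertex 0 (f (inord (v %% n))) else v.
have gE s i (Hs : s < 6) (Hi : i < n) : g (vertex s i) =
    vertex s (if s == 0 then f (inord i) : nat else i).
  rewrite /g; have [-> ->] := vertex_inj_code Hs Hi.
  by case: eqP => // ->.
have Hf s i : i < n -> (if s == 0 then f (inord i) : nat else i) < n.
  by case: ifP.
have f_nat i j : i < n -> j < n -> (f (inord i) == f (inord j)) = (i == j).
  move=> Hi Hj; rewrite (inj_eq f_inj) -val_eqE /= !inordK //.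
have g_inj : injective g.
  move=> x y; case: x / (vertexP x) => s i Hs Hi.
  case: y / (vertexP y) => t j Ht Hj.
  rewrite !gE // => /(eq_vertex Hs Ht (Hf _ _ Hi) (Hf _ _ Hj)) [-> E].
  congr vertex; apply/eqP; move: E; case: ifP => _ /eqP // .
  by rewrite val_eqE f_nat.
exists g; split; first exact: injF_bij.
have main s i t j : s < 6 -> t < 6 -> i < n -> j < n -> s <= t ->
   @adj G1 (g (vertex s i)) (g (vertex t j))
     = @adj G0 (vertex s i) (vertex t j).
  move=> Hs Ht Hi Hj st; rewrite !gE // !adj_vertex ?Hf //.
  case: s t Hs Ht st => [|s] [|t] // Hs Ht st.
  - rewrite /gadget_adj /= -!eqn_leq val_eqE f_nat //.
    case: (eqVneq i j) => //= ij; have := f_edge (inord i) (inord j).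
    by rewrite -val_eqE /= !inordK // => ->.
  - case: t Ht st => [|t] _ _ //.
    change (gadget_adj m n 1 0 1 (f (inord i)) j = m 2 i j).
    rewrite gadget_adj_label.
    apply/idP/idP => [/andP[/eqP fij /hasP[a]]|mij].
      rewrite mem_iota => /= Ha maj.
      have := f_pin (inord a) (inord j); rewrite !inordK // => /(_ maj) faj.
      have /eqP : f (inord i) == f (inord a).
        by rewrite faj -val_eqE /= fij inordK.
      by move/eqP; rewrite f_nat // => /eqP ->.
    have := f_pin (inord i) (inord j); rewrite !inordK // => /(_ mij) ->.
    rewrite inordK // eqxx andTb; apply/hasP; exists i => //.
    by rewrite mem_iota.
move=> x y; case: x / (vertexP x) => s i Hs Hi.
case: y / (vertexP y) => t j Ht Hj.
case: (leqP s t) => st; first exact: main.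
by rewrite adj_sym [RHS]adj_sym; apply: main => //; apply: ltnW.
Qed.

End GadgetGraph.

(** * The two reductions *)

Definition entries (A : fin_structure binary3) (r : nat) : nat -> nat -> bool :=
  entry_at A (match r with 0 => sym0 | 1 => sym1 | _ => sym2 end).

Lemma pinned_map_entries A f : pinned_map (entries A) f <-> @pinned_iso A f.
Proof.
rewrite /pinned_map /pinned_iso /edge_at /entries /entry_at /rel_at.
by split=> -[f_inj f_pin f_edge]; split=> // x y;
  move: (f_pin x y) (f_edge x y); rewrite !inord_val.
Qed.

Definition gadget_pair (A : fin_structure binary3) : graph * graph :=
  (gadget_graph (dom_pred A) (entries A) 0,
   gadget_graph (dom_pred A) (entries A) 1).

Lemma gadget_pair_poly_time (Psi : eso binary3) :
  @poly_time (eso_problem Psi) graph_isomorphism gadget_pair.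
Proof.
apply: (@poly_time_writes _ _ gadget_program) => // A.
have [Q HQ] := writes_gadgets (dom_pred A).+1 (entries A).
exists (dom_pred A).+1; eexists; exists Q; split.
  exact: encode_structureE.
rewrite [encode _]encode_structureE.
by rewrite [encode _](congr2 cat (encode_gadget_graph _ _ _)
  (encode_gadget_graph _ _ _)).
Qed.

Lemma pinned_iso_gadget_pair A : (exists f, @pinned_iso A f) <->
  isomorphic (gadget_pair A).1 (gadget_pair A).2.
Proof.
split=> [[f] /pinned_map_entries|]; first exact: pinned_map_gadget_isomorphic.
by case/gadget_isomorphic_pinned_map=> f Hf; exists f; apply/pinned_map_entries.
Qed.

Theorem mainTheorem10 :
  exists (tau : signature) (Psi : eso tau),
    extensional Psi /\ poly_equivalent (eso_problem Psi) graph_isomorphism.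
Proof.
exists binary3, pinned_iso_sentence; split.
  exact: extensional_pinned_iso_sentence.
split.
- exists gadget_pair; split=> [|A]; first exact: gadget_pair_poly_time.
  exact: iff_trans (eso_models_pinned_iso A) (pinned_iso_gadget_pair A).
- exists (fun p => pinned_structure p.1 p.2).
  split=> [|[G H]]; first exact: pinning_poly_time.
  apply: iff_trans (iff_sym (eso_models_pinned_iso _)).
  by split=> [/isomorphic_pinned_iso|[f /pinned_iso_isomorphic]].
Qed.
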